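(* Let $0<a<1$, $c_0>-1$ and $b\in\mathbb{R}$, and set $\lambda_k = ak+c_0+ib$ for $k=0,1,2,\dots$. Then the set $\mathcal{S}=\{\zeta^{\lambda_k}: k=0,1,2,\dots\}\subset A^2(\Delta)$ is a complete set in $A^2(\Delta)$.
   Context: $\Delta=\{\zeta\in\mathbb{C}: |\zeta-1|<1\}$. $A^2(\Delta)$ is the Bergman space, i.e. the Hilbert space of holomorphic functions on $\Delta$ that are square integrable with respect to Lebesgue measure $dA$, with the $L^2$ inner product. For $\lambda\in\mathbb{C}$, $\zeta^\lambda=e^{\lambda\log\zeta}$ with $\log$ the principal branch of the logarithm (note that $\Delta$ lies in the right half plane). A subset of a Hilbert space is complete if its linear span is dense; equivalently, if $0$ is the only vector orthogonal to all its elements. *)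

(* Defs.v *)
From HB Require Import structures.
From mathcomp Require Import all_boot all_order all_algebra.
From mathcomp Require Import all_classical all_reals all_analysis.
From mathcomp Require Import complex.

Set Implicit Arguments.
Unset Strict Implicit.
Unset Printing Implicit Defensive.

Import Order.TTheory GRing.Theory Num.Theory.
Import numFieldNormedType.Exports.
Import ComplexField.Normc.

Local Open Scope classical_set_scope.
Local Open Scope ring_scope.
Local Open Scope complex_scope.

Definition cexp {R : realType} (z : R[i]) : R[i] :=
  (expR (complex.Re z) * cos (complex.Im z)) +i* (expR (complex.Re z) * sin (complex.Im z)).

(* Principal argument, with values in ]-pi, pi] for z != 0. *)
Definition carg {R : realType} (z : R[i]) : R :=
  let t := acos (complex.Re z / normc z) in if 0 <= complex.Im z then t else - t.

(* Principal logarithm; only used for z != 0. *)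
Definition clog {R : realType} (z : R[i]) : R[i] := ln (normc z) +i* carg z.

Definition cpow {R : realType} (z lam : R[i]) : R[i] := cexp (lam * clog z).

(* On R[i], [<] relates only numbers with equal imaginary parts, and [`|z - 1|]
   is the modulus seen as an element of R[i], so this is the usual open disc. *)
Definition Delta (R : realType) : set R[i] := [set z | `|z - 1| < 1].
Arguments Delta R : clear implicits.

(* Complex differentiability at each point of D: the increment in [derivable]
   ranges over the field of scalars, here R[i] itself. *)
Definition holomorphic_on {R : realType} (D : set R[i]) (f : R[i] -> R[i]) :=
  forall z, D z -> derivable (f : R[i]^o -> R[i]^o) z 1.

(* R[i] carries no measurable structure in the library: area integrals over
   subsets of R[i] are taken on R * R, through (x, y) |-> x + iy. *)
Definition dA (R : realType) := (@lebesgue_measure R \x @lebesgue_measure R)%E.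
Arguments dA R : clear implicits.

Definition toC {R : realType} (p : R * R) : R[i] := p.1 +i* p.2.

Definition sqmod {R : realType} (f : R[i] -> R[i]) (p : R * R) : \bar R :=
  (normc (f (toC p)) ^+ 2)%:E.

Definition normL2 {R : realType} (D : set R[i]) (f : R[i] -> R[i]) : \bar R :=
  sqrte (\int[dA R]_(p in toC @^-1` D) sqmod f p)%E.

(* Elements are represented by total functions, of which only the restriction
   to D is relevant. *)
Definition Bergman {R : realType} (D : set R[i]) : set (R[i] -> R[i]) :=
  [set f | holomorphic_on D f /\ (dA R).-integrable (toC @^-1` D) (sqmod f)].

Definition linear_span {R : realType} (S : set (R[i] -> R[i])) :
    set (R[i] -> R[i]) :=
  [set g | exists (n : nat) (s : 'I_n -> R[i] -> R[i]) (c : 'I_n -> R[i]),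
    (forall i, S (s i)) /\ g = (fun z => \sum_(i < n) c i * s i z)].

Definition complete_in_Bergman {R : realType} (D : set R[i])
    (S : set (R[i] -> R[i])) :=
  forall f, Bergman D f -> forall e : R, 0 < e ->
    exists2 g, linear_span S g & (normL2 D (fun z => (f z - g z)%R) < e%:E)%E.

(* Main.v *)
(** Polynomials are dense in A^2(Delta): the dilations f(1 + r (z - 1)) converge
    to f in norm as r tends to 1, and each of them, being holomorphic around the
    closed disc, is a uniform limit of polynomials. Cauchy's formula, needed for
    the latter, comes from Goursat's bisection applied to s |-> f(e^s) on
    rectangles of height 2 pi, whose horizontal sides cancel by periodicity.

    It remains to approximate a polynomial p. Write p(z) = z^l0 G(z^a) with
    l0 = c0 + i b and G holomorphic on the right half plane. As a < 1, z^a maps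
    Delta into the disc |w - M| <= M with M = 1 / cos(a pi / 2). For e > 0,
    G(w + e) is holomorphic around that closed disc, hence there a uniform limit
    of polynomials P(w), and z^l0 P(z^a) is in the span of the z^(l0 + a k).
    Since z^l0 is square integrable (c0 > -1), z^l0 G(z^a + e) is in the closure
    of that span, and it tends to p in norm as e tends to 0 by dominated
    convergence. *)
Require Import Defs.
From mathcomp Require Import all_boot all_order all_algebra.
From mathcomp Require Import all_classical all_reals all_analysis.
From mathcomp Require Import complex measurable_realfun.
From mathcomp Require Import ring lra.

Import Order.TTheory GRing.Theory Num.Theory.
Import numFieldNormedType.Exports.
Import ComplexField.Normc.

Local Open Scope classical_set_scope.
Local Open Scope ring_scope.
Local Open Scope complex_scope.

Set Implicit Arguments.
Unset Strict Implicit.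
Unset Printing Implicit Defensive.

(** * Complex derivative, exponential, logarithm and powers *)

(** The hypothesis a < 1 enters through M: arguments in the image of Delta stay below a pi / 2 < pi
    / 2, so M is finite and the image lies in a disc tangent to the imaginary axis at 0. The
    obstacle is that 0, the branch point of G, lies on the boundary of that disc, and G may be
    unbounded there. Shifting by e pushes the singularity strictly outside, where uniform
    approximation works. Undoing the shift costs a majorant uniform in e, and C (1 + |z|^c0) is one:
    either the weight z^l0 absorbs the growth of G, or G is bounded near 0.

    In the variable s = log w circles become vertical segments, so that every contour integral is
    taken along segments parallel to the axes and Goursat's theorem for rectangles carries the whole
    theory. The price is that points of the negative real axis fall on the boundary of the strip:
    Cauchy's formula is proved off the real axis, and the resulting polynomial estimate is extended
    by continuity. *)

Definition has_cderiv {R : realType} (f : R[i] -> R[i]) (z d : R[i]) :=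
  forall e : R, 0 < e -> exists2 del : R, 0 < del & forall h, normc h < del ->
   normc (f (z+h) - f z - d*h) <= e*normc h.

Lemma Re_gt0E (R : realType) (e : R[i]) : 0 < e -> exists2 e' : R, 0 < e' & e = e'%:C.
Proof.
by case: e => a b; rewrite ltcE /= => /andP[/eqP -> a0]; exists a.
Qed.

Lemma normc_ge0 (R : realType) (z : R[i]) : 0 <= normc z.
Proof. by case: z => a b; rewrite /= sqrtr_ge0. Qed.

Lemma normc_gt0 (R : realType) (z : R[i]) : (0 < normc z) = (z != 0).
Proof.
rewrite lt_neqAle normc_ge0 andbT eq_sym; congr negb.
by apply/eqP/eqP => [/eq0_normc//|->]; rewrite normc0.
Qed.

Lemma normr_normc (R : realType) (z : R[i]) : `|z| = (normc z)%:C.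
Proof. by []. Qed.

Definition cdiff {R : realType} (f : R[i] -> R[i]) (z : R[i]) :=
  derivable (f : R[i]^o -> R[i]^o) z 1.

(** The bridge from [derivable] to estimates with real bounds: positive elements of [R[i]] are real,
    and multiplying by [normc h] instead of dividing by h lets h = 0 in. *)
Lemma cdiffP (R : realType) (f : R[i] -> R[i]) (z : R[i]) :
  cdiff f z <-> exists d, has_cderiv f z d.
Proof.
split.
  move=> /cvg_ex [d hd]; exists d => e e0.
  move/cvgrPdist_le : hd => /(_ e%:C); rewrite ltcR => /(_ e0).
  case => eps /= /Re_gt0E[del del0 ->] H; exists del => // h hdel.
  have [->|h0] := eqVneq h 0; first by rewrite addr0 subrr mulr0 subrr normc0 mulr0.
  have hb : ball_ [eta Num.Def.normr] 0 del%:C h by rewrite /ball_ /= sub0r normrN normr_normc ltcR.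
  have := H h hb h0.
  rewrite /GRing.scale /= mulr1 normr_normc lecR => H1.
  rewrite -ler_pdivrMr ?normc_gt0// -normcV -normcM -normcN.
  by congr (_ <= e) : H1; congr normc; rewrite [z + h]addrC; field.
move=> [d hd]; apply/cvg_ex; exists d.
apply/cvgrPdist_le => _ /Re_gt0E[e e0 ->].
have [del del0 H] := hd _ e0.
exists del%:C; first by rewrite /= ltcR.
move=> h; rewrite /ball_ /= sub0r normrN normr_normc ltcR => hdel h0.
rewrite normr_normc lecR /GRing.scale /= mulr1.
have := H h hdel; rewrite -ler_pdivrMr ?normc_gt0// -normcV -normcM -normcN.
by congr (_ <= e); congr normc; rewrite [z + h]addrC; field.
Qed.
Lemma normcB (R : realType) (x y : R[i]) : normc (x - y) = normc (y - x).
Proof. by rewrite -normcN opprB. Qed.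

Lemma le_normcB (R : realType) (x y : R[i]) : normc x - normc y <= normc (x - y).
Proof. by rewrite lerBlDr; apply: le_trans (le_normcD _ _); rewrite subrK. Qed.

Lemma normr_Re_le (R : realType) (z : R[i]) : `|complex.Re z| <= normc z.
Proof. by case: z => a b /=; rewrite -sqrtr_sqr ler_wsqrtr// lerDl sqr_ge0. Qed.

Lemma normr_Im_le (R : realType) (z : R[i]) : `|complex.Im z| <= normc z.
Proof. by case: z => a b /=; rewrite -sqrtr_sqr ler_wsqrtr// lerDr sqr_ge0. Qed.

Lemma normc_le_ReIm (R : realType) (z : R[i]) :
  normc z <= `|complex.Re z| + `|complex.Im z|.
Proof.
case: z => a b /=.
rewrite -[leRHS]ger0_norm ?addr_ge0// -sqrtr_sqr ler_wsqrtr//.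
rewrite sqrrD !real_normK ?num_real// addrAC lerDl.
by rewrite mulrn_wge0// mulr_ge0.
Qed.

Lemma sqr_normcE (R : realType) (z : R[i]) :
  normc z ^+ 2 = complex.Re z ^+ 2 + complex.Im z ^+ 2.
Proof. by case: z => a b /=; rewrite sqr_sqrtr// addr_ge0// sqr_ge0. Qed.

Lemma normc_sum (R : realType) (I : Type) (s : seq I) (F : I -> R[i]) :
  normc (\sum_(i <- s) F i) <= \sum_(i <- s) normc (F i).
Proof.
elim/big_ind2 : _ => //; first by rewrite normc0.
by move=> x1 x2 y1 y2 h1 h2; apply: le_trans (le_normcD _ _) _; rewrite lerD.
Qed.

Lemma normcX (R : realType) (z : R[i]) n : normc (z ^+ n) = normc z ^+ n.
Proof.
by elim: n => [|n ih]; rewrite ?expr0 ?normc1// !exprS normcM ih.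
Qed.

Lemma normc_real (R : realType) (x : R) : normc x%:C = `|x|.
Proof. by rewrite /= expr0n addr0 sqrtr_sqr. Qed.

Lemma Delta_normc (R : realType) (z : R[i]) : Delta R z <-> normc (z - 1) < 1.
Proof. by rewrite /Delta/= normr_normc ltcR. Qed.

Lemma mulcE (R : realType) (a b c d : R) :
  (a +i* b) * (c +i* d) = (a * c - b * d) +i* (a * d + b * c).
Proof. by []. Qed.

Lemma Re_mul (R : realType) (z w : R[i]) :
  complex.Re (z * w) = complex.Re z * complex.Re w - complex.Im z * complex.Im w.
Proof. by case: z w => a b [c d]. Qed.

Lemma Im_mul (R : realType) (z w : R[i]) :
  complex.Im (z * w) = complex.Re z * complex.Im w + complex.Im z * complex.Re w.
Proof. by case: z w => a b [c d]. Qed.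

Lemma Re_add (R : realType) (z w : R[i]) :
  complex.Re (z + w) = complex.Re z + complex.Re w.
Proof. by case: z w => a b [c d]. Qed.

Lemma Im_add (R : realType) (z w : R[i]) :
  complex.Im (z + w) = complex.Im z + complex.Im w.
Proof. by case: z w => a b [c d]. Qed.

Lemma Re_opp (R : realType) (z : R[i]) : complex.Re (- z) = - complex.Re z.
Proof. by case: z. Qed.

Lemma Im_opp (R : realType) (z : R[i]) : complex.Im (- z) = - complex.Im z.
Proof. by case: z. Qed.

Lemma cexpD (R : realType) (z w : R[i]) : cexp (z + w) = cexp z * cexp w.
Proof.
case: z w => a b [c d]; rewrite /cexp /= expRD cosD sinD mulcE.
by congr (_ +i* _); ring.
Qed.

Lemma cexp0 (R : realType) : cexp (0 : R[i]) = 1.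
Proof. by rewrite /cexp /= expR0 cos0 sin0 mulr1 mulr0. Qed.

Lemma normc_cexp (R : realType) (z : R[i]) : normc (cexp z) = expR (complex.Re z).
Proof.
rewrite /cexp /= !exprMn -mulrDr cos2Dsin2 mulr1 sqrtr_sqr ger0_norm//.
Qed.

Lemma cexp_neq0 (R : realType) (z : R[i]) : cexp z != 0.
Proof. by rewrite -normc_gt0 normc_cexp expR_gt0. Qed.

Lemma cexpM_nat (R : realType) (z : R[i]) n : cexp (n%:R * z) = cexp z ^+ n.
Proof.
elim: n => [|n ih]; first by rewrite mul0r cexp0 expr0.
by rewrite -natr1 mulrDl mul1r cexpD ih exprSr.
Qed.

Lemma cexp_2pi (R : realType) (z : R[i]) : cexp (z + (0 +i* (pi *+ 2))) = cexp z.
Proof.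
rewrite cexpD [X in _ * X]/cexp /= expR0 cos2pi sin2pi !mul1r.
by rewrite -[RHS]mulr1.
Qed.

Lemma real_diff0 (R : realType) (f : R -> R) (d : R) :
  is_derive (0 : R) (1 : R) f d -> forall e : R, 0 < e ->
  exists2 del : R, 0 < del & forall t, `|t| < del -> `|f t - f 0 - d * t| <= e * `|t|.
Proof.
move=> [/cvg_ex[l hl]]; rewrite /derive (cvg_lim _ hl)// => <- e e0.
have /cvgrPdist_le /(_ e e0)[del /= del0 H] := hl.
exists del => // t ht.
have [->|t0] := eqVneq t 0; first by rewrite subrr mulr0 subrr normr0 mulr0.
have hb : ball_ [eta Num.Def.normr] 0 del t by rewrite /ball_ /= sub0r normrN.
have := H t hb t0.
rewrite /GRing.scale /= mulr1 addr0 -normrN -ler_pdivrMr ?normr_gt0// -normfV -normrM.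
by congr (_ <= e); congr (`|_|); field.
Qed.

(** For h = x + iy, the real and imaginary errors split into the first-order errors of exp, cos and
    sin at 0, the trigonometric ones multiplied by e^x, and the second-order product (e^x - 1) y. *)
Lemma has_cderiv_cexp0 (R : realType) : has_cderiv (@cexp R) 0 1.
Proof.
move=> e e0.
(* The 9 is (3 + 1) + (3 + 2), the sum of the four bounds [K1], [K4], [K2], [K3] below; the 3 bounds
   e^x, since |x| <= eta <= 1. *)
have [eta [e8 eta1 etae]] : exists eta : R, [/\ 0 < eta, eta <= 1 & eta * 9 <= e].
  exists (Num.min (e / 9) 1); rewrite lt_min ltr01 divr_gt0//; split => //.
    by rewrite ge_min lexx orbT.
  by rewrite -ler_pdivlMr// ge_min lexx.
have [d1 d10 H1] := real_diff0 (is_derive_expR (0 : R)) e8.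
have [d2 d20 H2] := real_diff0 (is_derive_cos (0 : R)) e8.
have [d3 d30 H3] := real_diff0 (is_derive_sin (0 : R)) e8.
exists (Num.min (Num.min d1 eta) (Num.min d2 d3)).
  by rewrite !lt_min d10 e8 d20 d30.
move=> [x y]; rewrite !lt_min => /andP[/andP[h1 h2] /andP[h3 h4]].
have xh := normr_Re_le (x +i* y); have yh := normr_Im_le (x +i* y).
set n := normc _ in h1 h2 h3 h4 xh yh *; rewrite /= in xh yh.
have {H1} := H1 x (le_lt_trans xh h1); rewrite expR0 => H1.
have {H2} := H2 y (le_lt_trans yh h3); rewrite sin0 cos0 => H2.
have {H3} := H3 y (le_lt_trans yh h4); rewrite sin0 cos0 => H3.
rewrite add0r cexp0 mul1r; apply: le_trans (normc_le_ReIm _) _ => /=.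
have n0 : 0 <= n by exact: normc_ge0.
have Ex1 : `|expR x - 1| <= 2 * n.
  have -> : expR x - 1 = (expR x - 1 - 1 * x) + x by ring.
  apply: le_trans (ler_normD _ _) _.
  have : eta * `|x| <= 1 * n by rewrite ler_pM// ltW.
  lra.
have Ex : expR x <= 3.
  by move: Ex1; rewrite ler_norml => /andP[_]; lra.
have -> : expR x * cos y - 1 - x = expR x * (cos y - 1 - - 0 * y) + (expR x - 1 - 1 * x) by ring.
have -> : expR x * sin y - 0 - y = expR x * (sin y - 0 - 1 * y) + (expR x - 1) * y by ring.
apply: (@le_trans _ _ (9 * eta * n)); last by rewrite ler_wpM2r// mulrC.
have K1 : `|expR x * (cos y - 1 - - 0 * y)| <= 3 * (eta * n).
  rewrite normrM ger0_norm ?expR_ge0// ler_pM ?expR_ge0//.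
  by rewrite (le_trans H2)// ler_wpM2l// ltW.
have K2 : `|expR x * (sin y - 0 - 1 * y)| <= 3 * (eta * n).
  rewrite normrM ger0_norm ?expR_ge0// ler_pM ?expR_ge0//.
  by rewrite (le_trans H3)// ler_wpM2l// ltW.
have K3 : `|(expR x - 1) * y| <= 2 * eta * n.
  by rewrite normrM ler_pM// (le_trans Ex1)// ler_wpM2l// ltW.
have K4 : `|expR x - 1 - 1 * x| <= eta * n.
  by rewrite (le_trans H1)// ler_wpM2l// ltW.
apply: le_trans (lerD (ler_normD _ _) (ler_normD _ _)) _.
lra.
Qed.

Lemma cdiff_cexp (R : realType) (z : R[i]) :
  cdiff (@cexp R) z.
Proof.
apply/cdiffP; exists (cexp z) => e e0.
have n0 : 0 < normc (cexp z) by rewrite normc_cexp expR_gt0.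
have [del del0 H] := @has_cderiv_cexp0 R (e / normc (cexp z)) (divr_gt0 e0 n0).
exists del => // h /H; rewrite add0r cexp0 mul1r cexpD => {}H.
have -> : cexp z * cexp h - cexp z - cexp z * h = cexp z * (cexp h - 1 - h) by ring.
by rewrite normcM mulrC -ler_pdivlMr// mulrAC.
Qed.

Lemma Re_div_normc_itv (R : realType) (z : R[i]) :
  -1 <= complex.Re z / normc z <= 1.
Proof.
rewrite -ler_norml normrM normfV [X in _ / X]ger0_norm ?normc_ge0//.
have [->|z0] := eqVneq z 0; first by rewrite normc0 invr0 mulr0.
by rewrite ler_pdivrMr ?normc_gt0// mul1r normr_Re_le.
Qed.

Lemma carg_le_pi (R : realType) (z : R[i]) : `|carg z| <= pi.
Proof.
have h := Re_div_normc_itv z.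
rewrite /carg; case: ifPn => _; rewrite ?normrN ger0_norm ?acos_ge0 ?acos_lepi//.
Qed.

Lemma cos_carg (R : realType) (z : R[i]) : cos (carg z) = complex.Re z / normc z.
Proof.
have h := Re_div_normc_itv z.
by rewrite /carg; case: ifPn => _; rewrite ?cosN acosK// itv_boundlr.
Qed.

Lemma sin_carg (R : realType) (z : R[i]) : z != 0 ->
  sin (carg z) = complex.Im z / normc z.
Proof.
move=> z0; have h := Re_div_normc_itv z.
have n0 : 0 < normc z by rewrite normc_gt0.
have E : sin (acos (complex.Re z / normc z)) = `|complex.Im z| / normc z.
  rewrite sin_acos// -[RHS]ger0_norm ?divr_ge0 ?normc_ge0// -sqrtr_sqr; congr Num.sqrt.
  rewrite !expr_div_n real_normK ?num_real// sqr_normcE.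
  have : complex.Re z ^+ 2 + complex.Im z ^+ 2 != 0 by rewrite -sqr_normcE expf_neq0// gt_eqF.
  by move=> ?; field.
rewrite /carg; case: ifPn => i0; rewrite ?sinN E.
  by rewrite ger0_norm.
by rewrite ltr0_norm ?ltNge// mulNr opprK.
Qed.

Lemma cexp_clog (R : realType) (z : R[i]) : z != 0 -> cexp (clog z) = z.
Proof.
move=> z0; have n0 : 0 < normc z by rewrite normc_gt0.
rewrite /cexp /clog /= lnK ?posrE// cos_carg sin_carg//.
by rewrite ![normc z * _]mulrC !divfK ?gt_eqF//; case: (z).
Qed.

Lemma normr_carg_lt_pihalf (R : realType) (z : R[i]) :
  0 < complex.Re z -> `|carg z| < pi / 2.
Proof.
move=> z0; have n0 : 0 < normc z.
  by rewrite (lt_le_trans z0)// (le_trans _ (normr_Re_le _))// ler_norm.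
rewrite -ltr_cos ?in_itv /= ?normr_ge0 ?carg_le_pi//.
  by rewrite cos_pihalf cos_norm cos_carg divr_gt0.
have := pi_gt0 R; lra.
Qed.

Lemma normr_carg_lt_pi (R : realType) (z : R[i]) :
  complex.Im z != 0 -> `|carg z| < pi.
Proof.
move=> i0; rewrite lt_neqAle carg_le_pi andbT; apply/eqP => h.
have z0 : z != 0 by apply: contra i0 => /eqP ->.
have : `|sin (carg z)| = 0.
  have [c0|c0] := leP 0 (carg z); first by rewrite -(ger0_norm c0) h sinpi normr0.
  by rewrite -normrN -sinN -(ltr0_norm c0) h sinpi normr0.
move/eqP; rewrite sin_carg// normr_eq0 mulf_eq0 (negbTE i0) invr_eq0 gt_eqF//.
by rewrite normc_gt0.
Qed.

(** Moduli give equal real parts, and cos, even and injective on [0, pi], gives |Im s| = |Im t|.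
    Opposite values would force sin (Im t) = 0, hence Im t = 0 by the strict bound. That bound must
    be strict on one side, as pi and -pi have the same image. *)
Lemma cexp_inj (R : realType) (s t : R[i]) :
  `|complex.Im s| <= pi -> `|complex.Im t| < pi -> cexp s = cexp t -> s = t.
Proof.
case: s t => a b [c d] /= hb hd E.
have Ea : a = c.
  by apply: expR_inj; have := congr1 (@normc R) E; rewrite !normc_cexp.
subst c; move: E; rewrite /cexp /= => -[/(mulfI (lt0r_neq0 (expR_gt0 a))) Ec].
move=> /(mulfI (lt0r_neq0 (expR_gt0 a))) Es.
have hn : `|b| = `|d|.
  by apply: cos_inj; rewrite ?in_itv/= ?normr_ge0 ?(ltW hd)// !cos_norm.
congr (_ +i* _).
have /eqP := hn; rewrite eqr_norm2 => /orP[/eqP//|/eqP bd].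
have s0 : sin d = 0 by move: Es; rewrite bd sinN; lra.
have [d0|d0|d0] := ltgtP d 0; last by rewrite bd d0 oppr0.
  have := @sin_gt0_pi R (- d); rewrite sinN s0 oppr0 ltxx oppr_gt0 d0 /= => H.
  have : (false : Prop) by apply: H; rewrite -(ltr0_norm d0).
  by [].
have := @sin_gt0_pi R d; rewrite s0 ltxx d0 /= => H.
have : (false : Prop) by apply: H; rewrite -(gtr0_norm d0).
by [].
Qed.

Lemma clogK (R : realType) (s : R[i]) : `|complex.Im s| < pi -> clog (cexp s) = s.
Proof.
by move=> h; apply: cexp_inj => //; rewrite ?cexp_clog ?cexp_neq0//; exact: carg_le_pi.
Qed.

(** Near the positive real axis [carg] evaluates [acos] at its endpoint 1 and changes sign across
    the axis; [atan] makes the continuity there evident. *)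
Lemma carg_atan (R : realType) (z : R[i]) : 0 < complex.Re z ->
  carg z = atan (complex.Im z / complex.Re z).
Proof.
move=> z0; have := normr_carg_lt_pihalf z0; rewrite ltr_norml => h.
have zn0 : z != 0 by apply: contraTN z0 => /eqP ->; rewrite ltxx.
rewrite -[LHS]tanK ?in_itv//; congr atan.
rewrite /tan cos_carg sin_carg//.
have n0 : normc z != 0 by rewrite gt_eqF// normc_gt0.
by have ? := lt0r_neq0 z0; field; apply/andP.
Qed.

Lemma real_cont (R : realType) (f : R -> R) (x : R) :
  {for x, continuous f} -> forall e : R, 0 < e ->
  exists2 del : R, 0 < del & forall t, `|t - x| < del -> `|f t - f x| < e.
Proof.
move=> /cvgrPdist_lt h e /h [d /= d0 H]; exists d => // t ht.
by rewrite distrC; apply: H; rewrite /= distrC.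
Qed.

Lemma clog_near1 (R : realType) (e : R) : 0 < e ->
  exists2 del : R, 0 < del & forall u : R[i], normc u < del ->
    0 < complex.Re (1 + u) /\ normc (clog (1 + u)) <= e.
Proof.
move=> e0.
have e2 : 0 < e / 2 by rewrite divr_gt0.
have [d1 d10 H1] := real_cont (continuous_ln (@ltr01 R)) e2.
have [d2 d20 H2] := real_cont (@continuous_atan R 0) e2.
(* The 1 / 2 keeps Re (1 + u) above 1 / 2, so the argument Im / Re of [atan] is at most twice |u|;
   hence d2 / 2. *)
exists (Num.min (1 / 2) (Num.min d1 (d2 / 2))).
  by rewrite !lt_min d10 !divr_gt0.
move=> u; rewrite !lt_min => /andP[h1 /andP[h2 h3]].
have ru : `|complex.Re u| <= normc u := normr_Re_le u.
have iu : `|complex.Im u| <= normc u := normr_Im_le u.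
have r0 : 1 / 2 < complex.Re (1 + u).
  rewrite Re_add /=; move: ru; rewrite ler_norml => /andP[]; lra.
have r0' : 0 < complex.Re (1 + u) by lra.
split => //.
apply: le_trans (normc_le_ReIm _) _; rewrite /clog /= carg_atan//.
have -> : e = e / 2 + e / 2 by lra.
apply: lerD.
  rewrite -[ln _]subr0 -(ln1 R) ltW// H1// .
  rewrite (le_lt_trans _ h2)// ler_norml.
  apply/andP; split.
    rewrite -lerN2 opprK opprB -(normc1 R) -[in leRHS](normcN u).
    by rewrite (le_trans (le_normcB _ _))// opprD addNKr.
  by rewrite -[X in _ - X](normc1 R) (le_trans (le_normcB _ _))// addrAC subrr add0r.
rewrite -[atan _]subr0 -(atan0 R) ltW// H2// subr0 normrM normfV.
rewrite ltr_pdivrMr ?normr_gt0 ?gt_eqF// (gtr0_norm r0').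
have -> : complex.Im (1 + u) = complex.Im u by rewrite Im_add /= add0r.
rewrite (le_lt_trans iu)// (lt_le_trans h3)// ler_wpM2l// ?ltW//; lra.
Qed.
Lemma cdiff_comp (R : realType) (f g : R[i] -> R[i]) (z : R[i]) :
  cdiff g z -> cdiff f (g z) ->
  cdiff (fun x => f (g x)) z.
Proof.
move=> /derivable1_diffP hg /derivable1_diffP hf; apply/derivable1_diffP.
exact: (differentiable_comp hg hf).
Qed.

Lemma cdiffM (R : realType) (f g : R[i] -> R[i]) (z : R[i]) :
  cdiff f z -> cdiff g z ->
  cdiff (fun x => f x * g x) z.
Proof. by move=> hf hg; exact: (derivableM hf hg). Qed.

Lemma cdiffD (R : realType) (f g : R[i] -> R[i]) (z : R[i]) :
  cdiff f z -> cdiff g z ->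
  cdiff (fun x => f x + g x) z.
Proof. by move=> hf hg; exact: (derivableD hf hg). Qed.

Lemma cdiffB (R : realType) (f g : R[i] -> R[i]) (z : R[i]) :
  cdiff f z -> cdiff g z ->
  cdiff (fun x => f x - g x) z.
Proof. by move=> hf hg; exact: (derivableB hf hg). Qed.

Lemma cdiffV (R : realType) (f : R[i] -> R[i]) (z : R[i]) : f z != 0 ->
  cdiff f z ->
  cdiff (fun x => (f x)^-1) z.
Proof. by move=> h hf; exact: (derivableV h hf). Qed.

Lemma cdiff_cst (R : realType) (k z : R[i]) :
  cdiff (fun=> k) z.
Proof. exact: derivable_cst. Qed.

Lemma cdiff_id (R : realType) (z : R[i]) :
  cdiff (fun x => x) z.
Proof. exact: derivable_id. Qed.

Lemma cdiff_subc (R : realType) (k z : R[i]) :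
  cdiff (fun x => x - k) z.
Proof.
exact: (@cdiffB R (fun x => x) (fun=> k) z (@cdiff_id R z) (@cdiff_cst R k z)).
Qed.

Lemma cdiffX (R : realType) (f : R[i] -> R[i]) (z : R[i]) n :
  cdiff f z -> cdiff (fun w => f w ^+ n) z.
Proof.
move=> hf; elim: n => [|n ih]; first exact: cdiff_cst.
rewrite (_ : (fun w => _) = (fun w => f w * f w ^+ n)); first exact: cdiffM hf ih.
by apply/funext => u; rewrite exprS.
Qed.

Lemma cdiff_sum (R : realType) (z : R[i]) n (F : nat -> R[i] -> R[i]) :
  (forall i, cdiff (F i) z) -> cdiff (fun w => \sum_(i < n) F i w) z.
Proof.
move=> hF; elim: n => [|n ih].
  rewrite (_ : (fun w => _) = (fun=> 0)); first exact: cdiff_cst.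
  by apply/funext => u; rewrite big_ord0.
rewrite (_ : (fun w => _) = (fun w => \sum_(i < n) F i w + F n w)).
  exact: cdiffD ih (hF n).
by apply/funext => u; rewrite big_ord_recr.
Qed.

Lemma cdiff_horner (R : realType) (p : {poly R[i]}) (f : R[i] -> R[i]) (z : R[i]) :
  cdiff f z -> cdiff (fun w => p.[f w]) z.
Proof.
move=> hf; rewrite (_ : (fun w => _) = (fun w => \sum_(i < size p) p`_i * f w ^+ i)).
  apply: (@cdiff_sum R z (size p) (fun i w => p`_i * f w ^+ i)) => i.
  exact: (@cdiffM R (fun=> p`_i) _ z (@cdiff_cst R p`_i z) (@cdiffX R f z i hf)).
by apply/funext => w; rewrite horner_coef.
Qed.

(** Both arguments lie strictly between -pi / 2 and pi / 2, so their sum stays in the principal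
    range and no multiple of 2 pi i appears. *)
Lemma clogD1 (R : realType) (z u : R[i]) : 0 < complex.Re z ->
  0 < complex.Re (1 + u) -> clog (z + z * u) = clog z + clog (1 + u).
Proof.
move=> z0 u0.
have zn0 : z != 0 by apply: contraTN z0 => /eqP ->; rewrite ltxx.
have un0 : 1 + u != 0 by apply: contraTN u0 => /eqP ->; rewrite ltxx.
have E : z + z * u = z * (1 + u) by ring.
apply: cexp_inj; first exact: carg_le_pi.
  rewrite Im_add (le_lt_trans (ler_normD _ _))//.
  by rewrite (splitr pi) ltrD// normr_carg_lt_pihalf.
by rewrite cexpD !cexp_clog// ?E// mulf_neq0.
Qed.

(** Inverse function argument. With u = h / z and w = log (1 + u), the increment of the logarithm is
    w and the error is w - u. Since e^w = 1 + u, the expansion of exp at 0 bounds it by e' |w|. *)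
Lemma cdiff_clog (R : realType) (z : R[i]) : 0 < complex.Re z ->
  cdiff (@clog R) z.
Proof.
move=> z0; apply/cdiffP; exists z^-1 => e e0.
have zn0 : z != 0 by apply: contraTN z0 => /eqP ->; rewrite ltxx.
have nz0 : 0 < normc z by rewrite normc_gt0.
(* The bound 1 / 2 turns |u - w| <= e' |w| into |w| <= 2 |u|; the other one turns 2 e' |u| into e
   |z| |u| = e |h|. *)
pose e' := Num.min (1 / 2) (e * normc z / 2).
have e'0 : 0 < e' by rewrite lt_min !divr_gt0// mulr_gt0.
have e'1 : e' <= 1 / 2 by rewrite ge_min lexx.
have e'2 : e' <= e * normc z / 2 by rewrite ge_min lexx orbT.
have [d1 d10 H1] := has_cderiv_cexp0 e'0.
have d120 : 0 < d1 / 2 by rewrite divr_gt0.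
have [d2 d20 H2] := clog_near1 d120.
exists (d2 * normc z) => [|h hd]; first by rewrite mulr_gt0.
have hu : normc (h / z) < d2 by rewrite normcM normcV ltr_pdivrMr.
have [r0 wd] := H2 _ hu.
have -> : z + h = z + z * (h / z) by field.
rewrite clogD1//; set u := h / z in hu r0 wd *; set w := clog _ in wd *.
have Eh : h = z * u by rewrite /u; field.
have wu : cexp w = 1 + u.
  by rewrite cexp_clog//; apply: contraTN r0 => /eqP ->; rewrite ltxx.
have wd1 : normc w < d1 by apply: le_lt_trans wd _; lra.
have := H1 _ wd1; rewrite add0r cexp0 mul1r wu [1 + u]addrC addrK => K1.
have K2 : normc w <= 2 * normc u.
  have := le_normcB w u; rewrite normcB => K3.
  have : e' * normc w <= 1 / 2 * normc w by rewrite ler_wpM2r// normc_ge0.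
  lra.
have -> : clog z + w - clog z - z^-1 * h = w - u by rewrite Eh; field.
rewrite normcB (le_trans K1)// Eh normcM mulrA.
apply: le_trans (_ : e' * (2 * normc u) <= _); first by rewrite ler_wpM2l// ltW.
rewrite mulrA ler_wpM2r ?normc_ge0//; lra.
Qed.

Lemma cdiff_cpow (R : realType) (z l : R[i]) : 0 < complex.Re z ->
  cdiff (fun x => cpow x l) z.
Proof.
move=> z0; apply: (@cdiff_comp R (@cexp R) (fun x => l * clog x)).
  by apply: cdiffM; [exact: cdiff_cst | exact: cdiff_clog].
exact: cdiff_cexp.
Qed.

Lemma cpowD (R : realType) (z l m : R[i]) : cpow z (l + m) = cpow z l * cpow z m.
Proof. by rewrite /cpow mulrDl cexpD. Qed.

Lemma cpowM_nat (R : realType) (z l : R[i]) n : cpow z (n%:R * l) = cpow z l ^+ n.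
Proof. by rewrite /cpow -mulrA cexpM_nat. Qed.

Lemma normc_cpow (R : realType) (z l : R[i]) : z != 0 -> normc (cpow z l) =
  normc z `^ complex.Re l * expR (- (complex.Im l * carg z)).
Proof.
move=> z0; rewrite normc_cexp Re_mul /= /powR gt_eqF ?normc_gt0//.
by rewrite -expRD.
Qed.

Lemma normc_cpow_le (R : realType) (z l : R[i]) : z != 0 -> normc (cpow z l) <=
  normc z `^ complex.Re l * expR (`|complex.Im l| * pi).
Proof.
move=> z0; rewrite normc_cpow// ler_wpM2l ?powR_ge0// ler_expR.
rewrite (le_trans (ler_norm _))// normrN normrM ler_wpM2l// carg_le_pi//.
Qed.

Lemma Delta_Re (R : realType) (z : R[i]) : Delta R z -> 0 < complex.Re z.
Proof.
move=> /Delta_normc h; have := le_lt_trans (normr_Re_le _) h.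
by rewrite Re_add ltr_norml /= => /andP[]; lra.
Qed.

(** * Goursat's theorem and Cauchy's formula *)

Definition path_continuous {R : realType} (g : R -> R[i]) (x : R) :=
  forall e : R, 0 < e -> exists2 del : R, 0 < del &
    forall t, `|t - x| < del -> normc (g t - g x) < e.

(** An integral over the set [[a, b]], hence without orientation: it vanishes for b < a.
    Orientations are carried by explicit signs. *)
Definition cint {R : realType} (g : R -> R[i]) (a b : R) : R[i] :=
  (\int[@lebesgue_measure R]_(x in `[a, b]) complex.Re (g x)) +i*
  (\int[@lebesgue_measure R]_(x in `[a, b]) complex.Im (g x)).

Lemma path_continuous_Re (R : realType) (g : R -> R[i]) (x : R) : path_continuous g x ->
  {for x, continuous (fun t => complex.Re (g t))}.
Proof.
move=> h; apply/cvgrPdist_lt => e /h[d d0 H]; exists d => // t /= ht.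
rewrite -Re_opp -Re_add (le_lt_trans (normr_Re_le _))// normcB H//.
by rewrite distrC.
Qed.

Lemma path_continuous_Im (R : realType) (g : R -> R[i]) (x : R) : path_continuous g x ->
  {for x, continuous (fun t => complex.Im (g t))}.
Proof.
move=> h; apply/cvgrPdist_lt => e /h[d d0 H]; exists d => // t /= ht.
rewrite -Im_opp -Im_add (le_lt_trans (normr_Im_le _))// normcB H//.
by rewrite distrC.
Qed.

Lemma path_continuous_integrable (R : realType) (g : R -> R[i]) (a b : R) :
  {in `[a, b], forall x, path_continuous g x} ->
  (@lebesgue_measure R).-integrable `[a, b] (EFin \o (fun x => complex.Re (g x))) /\
  (@lebesgue_measure R).-integrable `[a, b] (EFin \o (fun x => complex.Im (g x))).
Proof.
move=> h; split; apply: continuous_compact_integrable;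
  try exact: segment_compact; apply: continuous_in_subspaceT => x /set_mem hx.
  exact/path_continuous_Re/h.
exact/path_continuous_Im/h.
Qed.

Lemma addcE (R : realType) (a b c d : R) :
  (a +i* b) + (c +i* d) = (a + c) +i* (b + d).
Proof. by []. Qed.

Lemma subcE (R : realType) (a b c d : R) :
  (a +i* b) - (c +i* d) = (a - c) +i* (b - d).
Proof. by []. Qed.

Lemma eq_cint (R : realType) (g h : R -> R[i]) (a b : R) :
  {in `[a, b], g =1 h} -> cint g a b = cint h a b.
Proof.
move=> gh; congr (_ +i* _); apply: eq_Rintegral => x /set_mem /gh ->//.
Qed.

Lemma cintB (R : realType) (g h : R -> R[i]) (a b : R) :
  {in `[a, b], forall x, path_continuous g x} -> {in `[a, b], forall x, path_continuous h x} ->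
  cint (fun x => g x - h x) a b = cint g a b - cint h a b.
Proof.
move=> /path_continuous_integrable[gr gi] /path_continuous_integrable[hr hi].
have mI : measurable `[a, b]%classic by exact: measurable_itv.
rewrite /cint subcE -!RintegralB//.
congr (_ +i* _); apply: eq_Rintegral => x _; rewrite ?Re_add ?Im_add ?Re_opp ?Im_opp//.
Qed.

Lemma cintZ (R : realType) (k : R[i]) (g : R -> R[i]) (a b : R) :
  {in `[a, b], forall x, path_continuous g x} ->
  cint (fun x => k * g x) a b = k * cint g a b.
Proof.
move=> /path_continuous_integrable[gr gi]; case: k => k l.
have mI : measurable `[a, b]%classic by exact: measurable_itv.
rewrite /cint mulcE -!RintegralZl// -RintegralB//; last 2 first.
- exact: (integrableZl _ k gr).
- exact: (integrableZl _ l gi).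
rewrite -RintegralD//; last 2 first.
- exact: (integrableZl _ k gi).
- exact: (integrableZl _ l gr).
by congr (_ +i* _); apply: eq_Rintegral => x _; rewrite ?Re_mul ?Im_mul.
Qed.

Lemma cint_cst (R : realType) (k : R[i]) (a b : R) : a <= b ->
  cint (fun=> k) a b = k * (b - a)%:C.
Proof.
move=> ab; case: k => k l.
rewrite /cint /= !Rintegral_cst//= !lebesgue_measure_itv/= lte_fin.
case: ltP ab => //= [_ _|h1 h2]; first by rewrite /real_complex_def /= mulcE !mulr0 subr0 add0r.
have -> : b = a by apply/eqP; rewrite eq_le h1 h2.
by rewrite subrr !mulr0.
Qed.

(** The factor 2 comes from bounding the real and imaginary parts separately; it is harmless, as the
    bound only serves to show that integrals are arbitrarily small. *)
Lemma cint_bound (R : realType) (g : R -> R[i]) (a b M : R) : a <= b ->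
  {in `[a, b], forall x, path_continuous g x} -> {in `[a, b], forall x, normc (g x) <= M} ->
  normc (cint g a b) <= 2 * M * (b - a).
Proof.
move=> ab /path_continuous_integrable[gr gi] gM.
have mI : measurable `[a, b]%classic by exact: measurable_itv.
apply: le_trans (normc_le_ReIm _) _ => /=.
have E : M * (b - a) = \int[@lebesgue_measure R]_(x in `[a, b]) M.
  rewrite Rintegral_cst//= !lebesgue_measure_itv/= lte_fin.
  case: ltP ab => //= h1 h2.
  have -> : b = a by apply/eqP; rewrite eq_le h1 h2.
  by rewrite subrr.
have iM : (@lebesgue_measure R).-integrable `[a, b] (EFin \o cst M).
  by apply: continuous_compact_integrable; [exact: segment_compact|move=> x; exact: cvg_cst].
have -> : 2 * M * (b - a) = M * (b - a) + M * (b - a) by ring.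
rewrite E; apply: lerD; (apply: le_trans; first exact: le_normr_Rintegral);
  apply: le_Rintegral => //.
- exact: (integrable_abse gr).
- by move=> x /gM; apply: le_trans; exact: normr_Re_le.
- exact: (integrable_abse gi).
- by move=> x /gM; apply: le_trans; exact: normr_Im_le.
Qed.

Lemma Rint_split (R : realType) (f : R -> R) (a b c : R) : a <= b -> b <= c ->
  (@lebesgue_measure R).-integrable `[a, c] (EFin \o f) ->
  \int[@lebesgue_measure R]_(x in `[a, c]) f x =
  \int[@lebesgue_measure R]_(x in `[a, b]) f x + \int[@lebesgue_measure R]_(x in `[b, c]) f x.
Proof.
move=> ab bc fi.
have := Rintegral_itvB fi (_ : (BLeft a <= BRight b)%O) (_ : (BRight b <= BRight c)%O).
rewrite !bnd_simp => /(_ ab bc) E.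
rewrite -(@Rintegral_itv_obnd_cbnd R b); first by rewrite -E; ring.
apply: integrableS fi; [exact: measurable_itv|exact: measurable_itv|].
by apply: subset_itvr => //; rewrite bnd_simp.
Qed.

Lemma cint_split (R : realType) (g : R -> R[i]) (a b c : R) : a <= b -> b <= c ->
  {in `[a, c], forall x, path_continuous g x} -> cint g a c = cint g a b + cint g b c.
Proof.
move=> ab bc /path_continuous_integrable[gr gi].
by rewrite /cint addcE -!(Rint_split ab bc).
Qed.

Definition ccontinuous {R : realType} (F : R[i] -> R[i]) (s : R[i]) :=
  forall e : R, 0 < e -> exists2 del : R, 0 < del &
    forall t, normc (t - s) < del -> normc (F t - F s) < e.

Lemma has_cderiv_ccontinuous (R : realType) (F : R[i] -> R[i]) (s d : R[i]) :
  has_cderiv F s d -> ccontinuous F s.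
Proof.
move=> hd e e0; have [del del0 H] := hd 1 ltr01.
have nd := normc_ge0 d.
have k0 : 0 < 1 + normc d by lra.
exists (Num.min del (e / (1 + normc d))) => [|t].
  by rewrite lt_min del0 divr_gt0.
rewrite lt_min ltr_pdivlMr// => /andP[h1 h2].
have := H (t - s) h1; rewrite mul1r [s + _]addrC subrK => K.
have -> : F t - F s = (F t - F s - d * (t - s)) + d * (t - s) by ring.
apply: le_lt_trans (le_normcD _ _) _; rewrite normcM.
by move: h2; rewrite [_ * (1 + _)]mulrDr mulr1; lra.
Qed.

Lemma ccontinuous_hor (R : realType) (F : R[i] -> R[i]) (y t : R) :
  ccontinuous F (t +i* y) -> path_continuous (fun t => F (t +i* y)) t.
Proof.
move=> h e /h[d d0 H]; exists d => // u hu; apply: H.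
by rewrite subcE subrr normc_real.
Qed.

Lemma ccontinuous_ver (R : realType) (F : R[i] -> R[i]) (x t : R) :
  ccontinuous F (x +i* t) -> path_continuous (fun t => F (x +i* t)) t.
Proof.
move=> h e /h[d d0 H]; exists d => // u hu; apply: H.
by rewrite subcE subrr /= expr0n add0r sqrtr_sqr.
Qed.

(** * Integrals along the boundary of a rectangle *)

Definition hint {R : realType} (F : R[i] -> R[i]) (y x1 x2 : R) :=
  cint (fun t => F (t +i* y)) x1 x2.
Definition vint {R : realType} (F : R[i] -> R[i]) (x y1 y2 : R) :=
  cint (fun t => F (x +i* t)) y1 y2.
(** Counterclockwise boundary integral: bottom minus top, then right minus left with the factor i of
    ds = i dt. *)
Definition rectint {R : realType} (F : R[i] -> R[i]) (x1 x2 y1 y2 : R) : R[i] :=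
  hint F y1 x1 x2 - hint F y2 x1 x2 + 'i%C * (vint F x2 y1 y2 - vint F x1 y1 y2).

Lemma hint_split (R : realType) (F : R[i] -> R[i]) (y a b c : R) : a <= b -> b <= c ->
  {in `[a, c], forall t, ccontinuous F (t +i* y)} -> hint F y a c = hint F y a b + hint F y b c.
Proof. by move=> ab bc h; apply: cint_split => // t /h/ccontinuous_hor. Qed.

Lemma vint_split (R : realType) (F : R[i] -> R[i]) (x a b c : R) : a <= b -> b <= c ->
  {in `[a, c], forall t, ccontinuous F (x +i* t)} -> vint F x a c = vint F x a b + vint F x b c.
Proof. by move=> ab bc h; apply: cint_split => // t /h/ccontinuous_ver. Qed.

Lemma rectint_splitx (R : realType) (F : R[i] -> R[i]) (x1 m x2 y1 y2 : R) :
  x1 <= m -> m <= x2 ->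
  {in `[x1, x2], forall t, ccontinuous F (t +i* y1)} -> {in `[x1, x2], forall t, ccontinuous F (t +i* y2)} ->
  rectint F x1 x2 y1 y2 = rectint F x1 m y1 y2 + rectint F m x2 y1 y2.
Proof.
by move=> h1 h2 c1 c2; rewrite /rectint !(hint_split h1 h2)//; ring.
Qed.

Lemma rectint_splity (R : realType) (F : R[i] -> R[i]) (x1 x2 y1 m y2 : R) :
  y1 <= m -> m <= y2 ->
  {in `[y1, y2], forall t, ccontinuous F (x1 +i* t)} -> {in `[y1, y2], forall t, ccontinuous F (x2 +i* t)} ->
  rectint F x1 x2 y1 y2 = rectint F x1 x2 y1 m + rectint F x1 x2 m y2.
Proof.
by move=> h1 h2 c1 c2; rewrite /rectint !(vint_split h1 h2)//; ring.
Qed.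

Definition rect {R : realType} (x1 x2 y1 y2 : R) : set R[i] :=
  [set s | x1 <= complex.Re s <= x2 /\ y1 <= complex.Im s <= y2].

Lemma rectint_bound (R : realType) (F : R[i] -> R[i]) (x1 x2 y1 y2 M : R) :
  x1 <= x2 -> y1 <= y2 ->
  {in `[x1, x2], forall t, [/\ ccontinuous F (t +i* y1), ccontinuous F (t +i* y2),
     normc (F (t +i* y1)) <= M & normc (F (t +i* y2)) <= M]} ->
  {in `[y1, y2], forall t, [/\ ccontinuous F (x1 +i* t), ccontinuous F (x2 +i* t),
     normc (F (x1 +i* t)) <= M & normc (F (x2 +i* t)) <= M]} ->
  normc (rectint F x1 x2 y1 y2) <= 4 * M * ((x2 - x1) + (y2 - y1)).
Proof.
move=> x12 y12 hx hy.
have h1 : normc (hint F y1 x1 x2) <= 2 * M * (x2 - x1).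
  by apply: cint_bound => // t /hx[/ccontinuous_hor].
have h2 : normc (hint F y2 x1 x2) <= 2 * M * (x2 - x1).
  by apply: cint_bound => // t /hx[_ /ccontinuous_hor].
have h3 : normc (vint F x1 y1 y2) <= 2 * M * (y2 - y1).
  by apply: cint_bound => // t /hy[/ccontinuous_ver].
have h4 : normc (vint F x2 y1 y2) <= 2 * M * (y2 - y1).
  by apply: cint_bound => // t /hy[_ /ccontinuous_ver].
apply: le_trans (le_normcD _ _) _; rewrite normcM.
have -> : normc ('i%C : R[i]) = 1 by rewrite /= expr0n expr1n add0r sqrtr1.
have := le_normcD (hint F y1 x1 x2) (- hint F y2 x1 x2).
have := le_normcD (vint F x2 y1 y2) (- vint F x1 y1 y2).
rewrite !normcN mul1r; lra.
Qed.

Lemma ccontinuous_affine (R : realType) (k d s0 s : R[i]) : ccontinuous (fun s => k + d * (s - s0)) s.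
Proof.
apply: (@has_cderiv_ccontinuous _ _ _ d) => e e0; exists 1 => // h _.
have -> : k + d * (s + h - s0) - (k + d * (s - s0)) - d * h = 0 by ring.
by rewrite normc0 mulr_ge0 ?normc_ge0 ?ltW.
Qed.

Lemma ccontinuousB (R : realType) (f g : R[i] -> R[i]) (s : R[i]) :
  ccontinuous f s -> ccontinuous g s -> ccontinuous (fun s => f s - g s) s.
Proof.
move=> cf cg e e0; have e20 : 0 < e / 2 by rewrite divr_gt0.
have [d1 d10 H1] := cf _ e20; have [d2 d20 H2] := cg _ e20.
exists (Num.min d1 d2) => [|t]; first by rewrite lt_min d10.
rewrite lt_min => /andP[/H1 K1 /H2 K2].
have -> : f t - g t - (f s - g s) = (f t - f s) - (g t - g s) by ring.
by apply: le_lt_trans (le_normcD _ _) _; rewrite normcN (splitr e) ltrD.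
Qed.

(** On opposite sides the integrands differ by a constant: d i (y1 - y2) for the horizontal pair, d
    (x2 - x1) for the vertical one. After integration the two contributions cancel. *)
Lemma rectint_affine (R : realType) (k d s0 : R[i]) (x1 x2 y1 y2 : R) :
  x1 <= x2 -> y1 <= y2 -> rectint (fun s => k + d * (s - s0)) x1 x2 y1 y2 = 0.
Proof.
move=> x12 y12.
have ch (y : R) : {in `[x1, x2], forall t : R, path_continuous (fun t => k + d * ((t +i* y) - s0)) t}.
  by move=> t _; apply: (@ccontinuous_hor _ (fun s => k + d * (s - s0))); exact: ccontinuous_affine.
have cv (x : R) : {in `[y1, y2], forall t : R, path_continuous (fun t => k + d * ((x +i* t) - s0)) t}.
  by move=> t _; apply: (@ccontinuous_ver _ (fun s => k + d * (s - s0))); exact: ccontinuous_affine.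
rewrite /rectint /hint /vint -!cintB//.
rewrite (@eq_cint _ _ (fun=> d * (0 +i* (y1 - y2)))); last first.
  move=> t _; have -> : (0 +i* (y1 - y2)) = (t +i* y1) - (t +i* y2).
    by rewrite subcE subrr.
  by ring.
rewrite cint_cst// (@eq_cint _ _ (fun=> d * (x2 - x1)%:C)) ?cint_cst//; last first.
  move=> t _; have -> : (x2 - x1)%:C = (x2 +i* t) - (x1 +i* t).
    by rewrite subcE subrr.
  by ring.
have -> : (0 +i* (y1 - y2)) = - 'i%C * (y2 - y1)%:C.
  by rewrite /real_complex_def /=; apply/eqP; rewrite eq_complex /= ; apply/andP; split; apply/eqP; ring.
by ring.
Qed.

Lemma rectintB (R : realType) (F G : R[i] -> R[i]) (x1 x2 y1 y2 : R) :
  (forall s, rect x1 x2 y1 y2 s -> ccontinuous F s) -> (forall s, rect x1 x2 y1 y2 s -> ccontinuous G s) ->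
  x1 <= x2 -> y1 <= y2 ->
  rectint (fun s => F s - G s) x1 x2 y1 y2 = rectint F x1 x2 y1 y2 - rectint G x1 x2 y1 y2.
Proof.
move=> hF hG x12 y12.
rewrite /rectint /hint /vint !cintB; try by ring.
all: move=> t; rewrite in_itv /= => /andP[h1 h2].
all: try apply: ccontinuous_hor; try apply: ccontinuous_ver.
all: (apply: hF || apply: hG).
all: by split; rewrite /= ?lexx ?h1 ?h2 ?x12 ?y12.
Qed.

(** * Goursat's theorem by bisection *)

Definition quad (R : realType) : Type := ((R * R) * (R * R))%type.

Definition quadint {R : realType} (F : R[i] -> R[i]) (Q : quad R) : R[i] :=
  rectint F Q.1.1 Q.1.2 Q.2.1 Q.2.2.

Definition quarter {R : realType} (bx by_ : bool) (Q : quad R) : quad R :=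
  let mx := (Q.1.1 + Q.1.2) / 2 in let my := (Q.2.1 + Q.2.2) / 2 in
  (if bx then (Q.1.1, mx) else (mx, Q.1.2), if by_ then (Q.2.1, my) else (my, Q.2.2)).

(* A quarter carrying at least a fourth of the integral; [subquad] tests only
   three of them, the last one being forced by [quadint_quarters]. *)
Definition subquad {R : realType} (F : R[i] -> R[i]) (Q : quad R) : quad R :=
  let big Q' := normc (quadint F Q) <= 4 * normc (quadint F Q') in
  if big (quarter true true Q) then quarter true true Q else
  if big (quarter true false Q) then quarter true false Q else
  if big (quarter false true Q) then quarter false true Q else quarter false false Q.

Definition wfquad {R : realType} (F : R[i] -> R[i]) (Q : quad R) :=
  [/\ Q.1.1 <= Q.1.2, Q.2.1 <= Q.2.2 &
    forall s, rect Q.1.1 Q.1.2 Q.2.1 Q.2.2 s -> ccontinuous F s].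

Lemma quadint_quarters (R : realType) (F : R[i] -> R[i]) (Q : quad R) : wfquad F Q ->
  quadint F Q = quadint F (quarter true true Q) + quadint F (quarter true false Q) +
           quadint F (quarter false true Q) + quadint F (quarter false false Q).
Proof.
case: Q => -[x1 x2] [y1 y2] [/= x12 y12 hF]; rewrite /quadint /quarter /=.
set mx := (x1 + x2) / 2; set my := (y1 + y2) / 2.
have hmx : x1 <= mx <= x2 by rewrite /mx; lra.
have hmy : y1 <= my <= y2 by rewrite /my; lra.
have /andP[xm mx2] := hmx; have /andP[ym my2] := hmy.
rewrite (rectint_splitx xm mx2); last 2 first.
- by move=> t; rewrite in_itv /= => ht; apply: hF; split; rewrite //= lexx y12.
- by move=> t; rewrite in_itv /= => ht; apply: hF; split; rewrite //= lexx y12.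
rewrite (rectint_splity ym my2); last 2 first.
- by move=> t; rewrite in_itv /= => ht; apply: hF; split; rewrite //= lexx x12.
- by move=> t; rewrite in_itv /= => ht; apply: hF; split; rewrite //= xm mx2.
rewrite (@rectint_splity _ _ mx x2 _ _ _ ym my2); last 2 first.
- by move=> t; rewrite in_itv /= => ht; apply: hF; split; rewrite //= ?xm ?mx2.
- by move=> t; rewrite in_itv /= => ht; apply: hF; split; rewrite //= lexx x12.
by ring.
Qed.

Lemma subquad_quarter (R : realType) (F : R[i] -> R[i]) (Q : quad R) :
  exists bx by_, subquad F Q = quarter bx by_ Q.
Proof.
rewrite /subquad; case: ifPn => _; [|case: ifPn => _; [|case: ifPn => _]];
 by [exists true, true|exists true, false|exists false, true|exists false, false].
Qed.

Lemma sum4_lt (R : realFieldType) (A a b c d : R) :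
  4 * a < A -> 4 * b < A -> 4 * c < A -> 4 * d < A -> a + b + c + d < A.
Proof. lra. Qed.

Lemma quadint_subquad (R : realType) (F : R[i] -> R[i]) (Q : quad R) : wfquad F Q ->
  normc (quadint F Q) <= 4 * normc (quadint F (subquad F Q)).
Proof.
move=> /quadint_quarters E; rewrite /subquad.
case: ifPn => //; rewrite -ltNge => h1; case: ifPn => //; rewrite -ltNge => h2.
case: ifPn => //; rewrite -ltNge => h3.
rewrite leNgt; apply/negP.
have : normc (quadint F Q) <= normc (quadint F (quarter true true Q)) + normc (quadint F (quarter true false Q)) +
    normc (quadint F (quarter false true Q)) + normc (quadint F (quarter false false Q)).
  rewrite E (le_trans (le_normcD _ _))// lerD2r (le_trans (le_normcD _ _))// lerD2r.
  exact: le_normcD.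
move=> h h4; by have := sum4_lt h1 h2 h3 h4; rewrite ltNge h.
Qed.

Lemma subquad_in (R : realType) (F : R[i] -> R[i]) (Q : quad R) : wfquad F Q ->
  [/\ wfquad F (subquad F Q),
    Q.1.1 <= (subquad F Q).1.1 /\ (subquad F Q).1.2 <= Q.1.2,
    Q.2.1 <= (subquad F Q).2.1 /\ (subquad F Q).2.2 <= Q.2.2,
    (subquad F Q).1.2 - (subquad F Q).1.1 = (Q.1.2 - Q.1.1) / 2 &
    (subquad F Q).2.2 - (subquad F Q).2.1 = (Q.2.2 - Q.2.1) / 2].
Proof.
have [bx [by_ ->]] := subquad_quarter F Q.
case: Q => -[x1 x2] [y1 y2] [/= x12 y12 hF].
case: bx; case: by_; rewrite /wfquad /quarter /=; (split; [split; [lra|lra|]|lra|lra|lra|lra]) => -[u v] [/= h1 h2];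
  apply: hF; split => /=; lra.
Qed.

(** The n-th rectangle keeps at least a 4^-n share of the integral. Near the limit point F is affine
    up to eta times the distance, and the affine part integrates to 0. The rest is at most 4 eta
    Ln^2 with Ln = L / 2^n, which exactly absorbs the factor 4^n. *)
Lemma goursat (R : realType) (F : R[i] -> R[i]) (x1 x2 y1 y2 : R) :
  x1 <= x2 -> y1 <= y2 ->
  (forall s, rect x1 x2 y1 y2 s -> exists d, has_cderiv F s d) ->
  rectint F x1 x2 y1 y2 = 0.
Proof.
move=> x12 y12 hF.
pose Q n : quad R := iter n (subquad F) ((x1, x2), (y1, y2)).
have wf n : wfquad F (Q n).
  elim: n => [|n ih] /=; last by have [] := subquad_in ih.
  by split => // s /hF[d]; exact: has_cderiv_ccontinuous.
have QS n : [/\ (Q n).1.1 <= (Q n.+1).1.1 /\ (Q n.+1).1.2 <= (Q n).1.2,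
    (Q n).2.1 <= (Q n.+1).2.1 /\ (Q n.+1).2.2 <= (Q n).2.2,
    (Q n.+1).1.2 - (Q n.+1).1.1 = ((Q n).1.2 - (Q n).1.1) / 2 &
    (Q n.+1).2.2 - (Q n.+1).2.1 = ((Q n).2.2 - (Q n).2.1) / 2].
  by have [] := subquad_in (wf n).
have Qw n : (Q n).1.2 - (Q n).1.1 = (x2 - x1) / 2 ^+ n /\
            (Q n).2.2 - (Q n).2.1 = (y2 - y1) / 2 ^+ n.
  elim: n => [|n [ih1 ih2]]; first by rewrite expr0 !divr1.
  have [_ _ -> ->] := QS n; rewrite ih1 ih2 exprS.
  have h : (2 : R) ^+ n != 0 by rewrite expf_neq0.
  by split; field.
have Qnest (m n : nat) : (m <= n)%N -> [/\ (Q m).1.1 <= (Q n).1.1, (Q n).1.2 <= (Q m).1.2,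
    (Q m).2.1 <= (Q n).2.1 & (Q n).2.2 <= (Q m).2.2].
  elim: n => [|n ih]; first by rewrite leqn0 => /eqP ->.
  rewrite leq_eqVlt => /predU1P[->//|/ih[a1 a2 a3 a4]].
  have [[b1 b2] [b3 b4] _ _] := QS n.
  by split; [exact: le_trans b1|exact: le_trans a2|exact: le_trans b3|exact: le_trans a4].
have Qcross (m n : nat) : (Q m).1.1 <= (Q n).1.2 /\ (Q m).2.1 <= (Q n).2.2.
  have [wa wb _] := wf m; have [wc wd _] := wf n.
  have [/Qnest[a1 a2 a3 a4]|/ltnW/Qnest[a1 a2 a3 a4]] := leqP m n; split; lra.
(* Every lower corner is below every upper corner by [Qcross], so the suprema of the lower corners
   give a point common to all the rectangles. *)
pose xs := sup (range (fun n => (Q n).1.1)); pose ys := sup (range (fun n => (Q n).2.1)).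
have xsP n : (Q n).1.1 <= xs <= (Q n).1.2.
  apply/andP; split.
    apply: ub_le_sup; last by exists n.
    by exists (Q 0%N).1.2 => _ [m _ <-]; exact: (Qcross m 0%N).1.
  apply: ge_sup; first by exists (Q 0%N).1.1; exists 0%N.
  by move=> _ [m _ <-]; exact: (Qcross m n).1.
have ysP n : (Q n).2.1 <= ys <= (Q n).2.2.
  apply/andP; split.
    apply: ub_le_sup; last by exists n.
    by exists (Q 0%N).2.2 => _ [m _ <-]; exact: (Qcross m 0%N).2.
  apply: ge_sup; first by exists (Q 0%N).2.1; exists 0%N.
  by move=> _ [m _ <-]; exact: (Qcross m n).2.
have [d hd] : exists d, has_cderiv F (xs +i* ys) d by apply: hF; split; [exact: (xsP 0%N)|exact: (ysP 0%N)].
pose L := (x2 - x1) + (y2 - y1).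
have L0 : 0 <= L by rewrite /L; lra.
have JQn n : normc (rectint F x1 x2 y1 y2) <= 4 ^+ n * normc (quadint F (Q n)).
  elim: n => [|n ih]; first by rewrite expr0 mul1r.
  apply: le_trans ih _; rewrite exprSr -mulrA ler_wpM2l ?exprn_ge0//.
  exact: quadint_subquad.
apply: eq0_normc; apply/eqP; rewrite eq_le normc_ge0 andbT.
apply/ler_addgt0Pl => e e0; rewrite addr0.
(* The final bound is 4 eta L^2; the added 1 keeps the denominator positive when the rectangle is
   reduced to a point. *)
pose eta := e / (4 * L ^+ 2 + 1).
have K0 : 0 < 4 * L ^+ 2 + 1 by rewrite ltr_wpDl// mulr_ge0// sqr_ge0.
have eta0 : 0 < eta by rewrite divr_gt0.
have [del del0 H] := hd eta eta0.
have [n hn] : exists n : nat, L / 2 ^+ n < del.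
  exists (Num.bound (L / del)).
  rewrite ltr_pdivrMr ?exprn_gt0// mulrC -ltr_pdivrMr//.
  have Ld0 : 0 <= L / del by rewrite divr_ge0// ltW.
  rewrite (lt_le_trans (archi_boundP Ld0))// -natrX ler_nat.
  exact/ltnW/ltn_expl.
apply: le_trans (JQn n) _.
have [wx wy wF] := wf n.
set Ln := L / 2 ^+ n in hn.
have Ln0 : 0 <= Ln by rewrite divr_ge0// exprn_ge0.
have LnE : ((Q n).1.2 - (Q n).1.1) + ((Q n).2.2 - (Q n).2.1) = Ln.
  have h : (2 : R) ^+ n != 0 by rewrite expf_neq0.
  by have [-> ->] := Qw n; rewrite /Ln /L; field.
pose A s := F (xs +i* ys) + d * (s - (xs +i* ys)).
have JE : quadint F (Q n) = rectint (fun s => F s - A s) (Q n).1.1 (Q n).1.2 (Q n).2.1 (Q n).2.2.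
  rewrite rectintB//; last by move=> s _; exact: ccontinuous_affine.
  by rewrite rectint_affine// subr0.
have FA s : rect (Q n).1.1 (Q n).1.2 (Q n).2.1 (Q n).2.2 s -> ccontinuous (fun s => F s - A s) s.
  by move=> /wF cF; apply: (@ccontinuousB R F A) => //; exact: ccontinuous_affine.
have FAb s : rect (Q n).1.1 (Q n).1.2 (Q n).2.1 (Q n).2.2 s -> normc (F s - A s) <= eta * Ln.
  move=> [hx hy].
  have nL : normc (s - (xs +i* ys)) <= Ln.
    rewrite -LnE; apply: le_trans (normc_le_ReIm _) _.
    have := xsP n; have := ysP n; rewrite !Re_add !Im_add Re_opp Im_opp /=.
    move=> hys hxs; apply: lerD; rewrite ler_norml; lra.
  have := H (s - (xs +i* ys)) (le_lt_trans nL hn).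
  rewrite [_ +i* _ + _]addrC subrK /A => K.
  have -> : F s - (F (xs +i* ys) + d * (s - (xs +i* ys))) =
    F s - F (xs +i* ys) - d * (s - (xs +i* ys)) by ring.
  by rewrite (le_trans K)// ler_wpM2l// ltW.
rewrite JE; apply: le_trans (_ : 4 ^+ n * (4 * (eta * Ln) * Ln) <= _).
  rewrite ler_wpM2l ?exprn_ge0// -{2}LnE.
  apply: rectint_bound => // t; rewrite in_itv /= => ht.
    have r1 : rect (Q n).1.1 (Q n).1.2 (Q n).2.1 (Q n).2.2 (t +i* (Q n).2.1).
      by split; rewrite //= lexx.
    have r2 : rect (Q n).1.1 (Q n).1.2 (Q n).2.1 (Q n).2.2 (t +i* (Q n).2.2).
      by split; rewrite //= lexx andbT.
    by split; [exact: FA|exact: FA|exact: FAb|exact: FAb].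
  have r1 : rect (Q n).1.1 (Q n).1.2 (Q n).2.1 (Q n).2.2 ((Q n).1.1 +i* t).
    by split; rewrite //= lexx.
  have r2 : rect (Q n).1.1 (Q n).1.2 (Q n).2.1 (Q n).2.2 ((Q n).1.2 +i* t).
    by split; rewrite //= lexx andbT.
  by split; [exact: FA|exact: FA|exact: FAb|exact: FAb].
have -> : 4 ^+ n * (4 * (eta * Ln) * Ln) = eta * (4 * L ^+ 2).
  have h : (2 : R) ^+ n != 0 by rewrite expf_neq0.
  have -> : (4 : R) ^+ n = 2 ^+ n * 2 ^+ n by rewrite -exprMn; congr (_ ^+ _); ring.
  by rewrite /Ln; field.
rewrite /eta -mulrA ler_piMr ?(ltW e0)//.
by rewrite mulrC ler_pdivrMr// mul1r; lra.
Qed.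

(** * Cauchy's theorem and formula in the logarithmic variable *)

Lemma has_cderiv_comp_cexp (R : realType) (H : R[i] -> R[i]) (s : R[i]) :
  cdiff H (cexp s) -> exists d, has_cderiv (fun s => H (cexp s)) s d.
Proof.
move=> h; apply/cdiffP; apply: (cdiff_comp _ h); exact: cdiff_cexp.
Qed.

Lemma rectint_cexp (R : realType) (H : R[i] -> R[i]) (x1 x2 : R) :
  rectint (fun s => H (cexp s)) x1 x2 (- pi) pi =
  'i%C * (vint (fun s => H (cexp s)) x2 (- pi) pi - vint (fun s => H (cexp s)) x1 (- pi) pi).
Proof.
suff E : hint (fun s => H (cexp s)) (- pi) x1 x2 = hint (fun s => H (cexp s)) pi x1 x2.
  by rewrite /rectint E subrr add0r.
apply: eq_cint => t _; rewrite -cexp_2pi addcE addr0; congr (H (cexp (_ +i* _))).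
by rewrite mulr2n; ring.
Qed.

Lemma mulic_eq0 (R : realType) (u v : R[i]) : 'i%C * (u - v) = 0 -> u = v.
Proof.
move/eqP; rewrite mulf_eq0 => /orP[/eqP/(congr1 (@complex.Im R))/eqP|].
  by rewrite /= oner_eq0.
by rewrite subr_eq0 => /eqP.
Qed.

(** Cauchy's theorem on the annulus, which is the image under exp of a rectangle of height 2 pi. The
    radius may thus be sent to infinity in [winding] and to 0 in [cauchy_key]. *)
Lemma circle_const (R : realType) (H : R[i] -> R[i]) (x1 x2 : R) : x1 <= x2 ->
  (forall z, expR x1 <= normc z <= expR x2 -> cdiff H z) ->
  vint (fun s => H (cexp s)) x2 (- pi) pi = vint (fun s => H (cexp s)) x1 (- pi) pi.
Proof.
move=> x12 dH; apply: mulic_eq0; rewrite -rectint_cexp; apply: goursat => //.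
  by have := pi_ge0 R; lra.
move=> s [/andP[h1 h2] _]; apply: has_cderiv_comp_cexp; apply: dH.
by rewrite normc_cexp !ler_expR h1.
Qed.

Lemma cdiff_ccontinuous (R : realType) (f : R[i] -> R[i]) (z : R[i]) :
  cdiff f z -> ccontinuous f z.
Proof. by move/cdiffP => [d]; exact: has_cderiv_ccontinuous. Qed.

(* The integrals over vertical segments of length 2 pi are contour integrals over
   circles in the variable w = e^s, with ds = dw / (i w). *)
Lemma winding (R : realType) (z : R[i]) (x : R) : normc z < expR x ->
  vint (fun s => cexp s / (cexp s - z)) x (- pi) pi = (2 * pi)%:C.
Proof.
move=> zx; have p0 := pi_gt0 R; have zg := normc_ge0 z.
(* w / (w - z) = 1 + H w: the constant 1 yields 2 pi, and H tends to 0 at infinity, so its integral,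
   independent of the radius, is 0. *)
pose H (w : R[i]) := z / (w - z).
have wz w : normc z < normc w -> w - z != 0.
  by apply: contraTN; rewrite subr_eq0 => /eqP ->; rewrite ltxx.
have dH w : normc z < normc w -> cdiff H w.
  move=> /wz h; apply: cdiffM; first exact: cdiff_cst.
  apply: (@cdiffV R (fun w => w - z)) => //.
  exact: cdiff_subc.
have cH X t : x <= X -> path_continuous (fun t => H (cexp (X +i* t))) t.
  move=> xX; apply: (@ccontinuous_ver _ (fun s => H (cexp s))).
  have [|d] := @has_cderiv_comp_cexp R H (X +i* t); last by exact: has_cderiv_ccontinuous.
  by apply: dH; rewrite normc_cexp (lt_le_trans zx)// ler_expR.
have H0 : vint (fun s => H (cexp s)) x (- pi) pi = 0.
  apply: eq0_normc; apply/eqP; rewrite eq_le normc_ge0 andbT.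
  apply/ler_addgt0Pl => e e0; rewrite addr0.
  (* The first term makes the new circle larger than the given one, the second keeps r - |z|
     positive, and the third makes the bound 4 pi |z| / (r - |z|) at most e. *)
  pose r := expR x + normc z + normc z * (4 * pi) / e.
  have K0 : 0 <= normc z * (4 * pi) / e by rewrite divr_ge0 ?mulr_ge0// ltW.
  have ex0 := expR_gt0 x.
  have r0 : 0 < r by rewrite /r; lra.
  have xr : x <= ln r by rewrite -ler_expR lnK ?posrE// /r; lra.
  rewrite -(@circle_const _ _ x (ln r))//; last first.
    by move=> w /andP[h _]; apply: dH; exact: lt_le_trans h.
  have D0 : 0 < r - normc z by rewrite /r; lra.
  apply: le_trans (_ : 2 * (normc z / (r - normc z)) * (pi - - pi) <= _).
    apply: cint_bound; first by lra.
      by move=> t _; exact: cH.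
    move=> t _; rewrite /H normcM normcV ler_wpM2l// lef_pV2 ?posrE//.
      by rewrite (le_trans _ (le_normcB _ _))// normc_cexp /= lnK.
    by rewrite normc_gt0 wz// normc_cexp /= lnK ?posrE// /r; lra.
  have D0' := lt0r_neq0 D0; have e0' := lt0r_neq0 e0.
  have -> : 2 * (normc z / (r - normc z)) * (pi - - pi) =
      normc z * (4 * pi) / (r - normc z) by field.
  rewrite ler_pdivrMr//.
  have -> : e * (r - normc z) = e * expR x + normc z * (4 * pi) by rewrite /r; field.
  by rewrite lerDr mulr_ge0 ?ltW.
have cne t : cexp (x +i* t) - z != 0 by apply: wz; rewrite normc_cexp.
move: H0; rewrite {1}/vint (@eq_cint _ _ (fun t => cexp (x +i* t) / (cexp (x +i* t) - z) - 1)); last first.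
  by move=> t _; rewrite /H; have := cne t => ?; field.
rewrite cintB ?cint_cst; last 3 first.
- by lra.
- move=> t _; apply: (@ccontinuous_ver _ (fun s => cexp s / (cexp s - z))).
  have [|d] := @has_cderiv_comp_cexp R (fun w => w / (w - z)) (x +i* t); last by exact: has_cderiv_ccontinuous.
  apply: (@cdiffM R id (fun w => (w - z)^-1)); first exact: cdiff_id.
  by apply: (@cdiffV R (fun w => w - z)) => //; exact: cdiff_subc.
- by move=> t _ e e0; exists 1 => // u _; rewrite subrr normc0.
by rewrite mul1r opprK => /eqP; rewrite subr_eq0 => /eqP; rewrite /vint => ->; congr (_%:C); ring.
Qed.

(** Cutting along x = a and x = b, then the middle strip along y = c and y = d, leaves the hole and
    four rectangles on which Goursat's theorem applies. *)
Lemma rectint_hole (R : realType) (G : R[i] -> R[i]) (x1 a b x2 y1 c d y2 : R) :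
  x1 <= a -> a <= b -> b <= x2 -> y1 <= c -> c <= d -> d <= y2 ->
  (forall s, rect x1 x2 y1 y2 s ->
    [\/ complex.Re s <= a, b <= complex.Re s, complex.Im s <= c | d <= complex.Im s] ->
    exists d, has_cderiv G s d) ->
  rectint G x1 x2 y1 y2 = rectint G a b c d.
Proof.
move=> xa ab bx yc cd dy dG.
have ax : a <= x2 by exact: le_trans bx.
have cy : c <= y2 by exact: le_trans dy.
have x12 : x1 <= x2 by exact: le_trans ax.
have y12 : y1 <= y2 by exact: le_trans cy.
have xb : x1 <= b by exact: le_trans ab.
have yd : y1 <= d by exact: le_trans cd.
have cG s : rect x1 x2 y1 y2 s ->
    [\/ complex.Re s <= a, b <= complex.Re s, complex.Im s <= c | d <= complex.Im s] -> ccontinuous G s.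
  by move=> h1 h2; have [l] := dG s h1 h2; exact: has_cderiv_ccontinuous.
have chor y u v : x1 <= u -> v <= x2 -> y1 <= y <= y2 -> y <= c \/ d <= y ->
    {in `[u, v], forall t, ccontinuous G (t +i* y)}.
  move=> hu hv hy hyc t; rewrite in_itv /= => /andP[h1 h2]; apply: cG.
    by split => //=; rewrite (le_trans hu)//= (le_trans h2).
  by case: hyc => ?; [constructor 3|constructor 4].
have cver x u v : y1 <= u -> v <= y2 -> x1 <= x <= x2 -> x <= a \/ b <= x ->
    {in `[u, v], forall t, ccontinuous G (x +i* t)}.
  move=> hu hv hy hyc t; rewrite in_itv /= => /andP[h1 h2]; apply: cG.
    by split => //=; rewrite (le_trans hu)//= (le_trans h2).
  by case: hyc => ?; [constructor 1|constructor 2].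
have G0 u1 u2 v1 v2 : x1 <= u1 -> u1 <= u2 -> u2 <= x2 -> y1 <= v1 -> v1 <= v2 -> v2 <= y2 ->
    [\/ u2 <= a, b <= u1, v2 <= c | d <= v1] -> rectint G u1 u2 v1 v2 = 0.
  move=> h1 h2 h3 h4 h5 h6 hs; apply: goursat => // s [/andP[r1 r2] /andP[r3 r4]].
  apply: dG; first by split; rewrite ?(le_trans h1 r1) ?(le_trans r2 h3) ?(le_trans h4 r3) ?(le_trans r4 h6).
  case: hs => h.
  - by constructor 1; exact: le_trans h.
  - by constructor 2; exact: le_trans r1.
  - by constructor 3; exact: le_trans h.
  - by constructor 4; exact: le_trans r3.
rewrite (rectint_splitx xa ax); [|by apply: chor; rewrite ?lexx ?y12//; left|
  by apply: chor; rewrite ?lexx ?y12//; right].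
rewrite (G0 x1) ?add0r//; last by constructor 1.
rewrite (rectint_splitx ab bx); [|by apply: chor; rewrite ?lexx ?y12//; left|
  by apply: chor; rewrite ?lexx ?y12//; right].
rewrite (G0 b) ?addr0//; last by constructor 2.
rewrite (rectint_splity yc cy); [|by apply: cver; rewrite ?lexx ?xa ?ax//; left|
  by apply: cver; rewrite ?lexx ?xb ?bx//; right].
rewrite (G0 a b y1 c) ?add0r//; last by constructor 3.
rewrite (rectint_splity cd dy); [|by apply: cver; rewrite ?lexx ?xa ?ax//; left|
  by apply: cver; rewrite ?lexx ?xb ?bx//; right].
by rewrite (G0 a b d y2) ?addr0//; constructor 4.
Qed.

(** The rectangle is contracted to a square of half-side dl around s0, on whose boundary G is
    bounded by B; the integral is then O(B dl). *)
Lemma goursat_removable (R : realType) (G : R[i] -> R[i]) (s0 : R[i])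
    (x1 x2 y1 y2 B d1 : R) :
  x1 < complex.Re s0 < x2 -> y1 < complex.Im s0 < y2 -> 0 < B -> 0 < d1 ->
  (forall s, rect x1 x2 y1 y2 s -> s != s0 -> exists d, has_cderiv G s d) ->
  (forall s, rect x1 x2 y1 y2 s -> normc (s - s0) < d1 -> normc (G s) <= B) ->
  rectint G x1 x2 y1 y2 = 0.
Proof.
case: s0 => x0 y0 /= /andP[x10 x02] /andP[y10 y02] B0 d10 dG GB.
apply: eq0_normc; apply/eqP; rewrite eq_le normc_ge0 andbT.
apply/ler_addgt0Pl => e e0; rewrite addr0.
(* The sum of width and height of the square is 4 dl, so [rectint_bound] gives 16 B dl. The
   condition dl + dl < d1 puts the boundary within d1 of s0, the modulus being bounded by |Re| +
   |Im|. *)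
have [dl [dl0 [h1 h2] [h3 h4] dl1 dle]] : exists dl : R,
    [/\ 0 < dl, dl <= x0 - x1 /\ dl <= x2 - x0, dl <= y0 - y1 /\ dl <= y2 - y0,
        dl + dl < d1 & 16 * B * dl <= e].
  exists (Num.min (Num.min (x0 - x1) (x2 - x0)) (Num.min (Num.min (y0 - y1) (y2 - y0))
       (Num.min d1 (e / B))) / 16).
  set m := Num.min _ _.
  have m0 : 0 < m by rewrite !lt_min d10 divr_gt0// !subr_gt0 x10 x02 y10 y02.
  have : m <= m by []. rewrite {2}/m !le_min => /andP[/andP[m1 m2] /andP[/andP[m3 m4] /andP[m5 m6]]].
  clearbody m; clear dG GB; split; [lra|split; lra|split; lra|lra|].
  by have := m6; rewrite ler_pdivlMr// => ?; lra.
have ne (s : R[i]) : complex.Re s != x0 \/ complex.Im s != y0 -> s != x0 +i* y0.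
  by case=> /eqP h; apply/eqP => E; apply: h; rewrite E.
have bd (u v : R) : `|u - x0| <= dl -> `|v - y0| <= dl -> u != x0 \/ v != y0 ->
   ccontinuous G (u +i* v) /\ normc (G (u +i* v)) <= B.
  move=> hu hv hne.
  have ruv : rect x1 x2 y1 y2 (u +i* v).
    by clear dG GB; move: hu hv; rewrite /rect /= !ler_norml; lra.
  split.
    by have [|d] := dG _ ruv; [exact: ne|exact: has_cderiv_ccontinuous].
  apply: GB => //.
  rewrite subcE (le_lt_trans (normc_le_ReIm _))//= (le_lt_trans _ dl1)//.
  exact: lerD.
rewrite (@rectint_hole _ _ x1 (x0 - dl) (x0 + dl) x2 y1 (y0 - dl) (y0 + dl) y2);
  try by clear dG GB bd ne; lra.
  have E : (x0 + dl - (x0 - dl)) + (y0 + dl - (y0 - dl)) = 4 * dl by ring.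
  apply: le_trans (_ : 4 * B * (4 * dl) <= _); last by clear dG GB bd ne; lra.
  have pm : `|(x0 + dl) - x0| <= dl /\ `|(x0 - dl) - x0| <= dl.
    by rewrite addrAC subrr add0r addrAC subrr add0r normrN gtr0_norm.
  have pm' : `|(y0 + dl) - y0| <= dl /\ `|(y0 - dl) - y0| <= dl.
    by rewrite addrAC subrr add0r addrAC subrr add0r normrN gtr0_norm.
  have nxb : x0 + dl != x0 by rewrite gt_eqF// ltrDl.
  have nxa : x0 - dl != x0 by rewrite lt_eqF// gtrDl oppr_lt0.
  have nyb : y0 + dl != y0 by rewrite gt_eqF// ltrDl.
  have nya : y0 - dl != y0 by rewrite lt_eqF// gtrDl oppr_lt0.
  rewrite -E; apply: rectint_bound; try by clear dG GB bd ne; lra.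
    move=> t; rewrite in_itv /= -ler_distlC distrC => ht.
    have [? ?] := bd _ _ ht pm'.1 (or_intror nyb).
    by have [? ?] := bd _ _ ht pm'.2 (or_intror nya).
  move=> t; rewrite in_itv /= -ler_distlC distrC => ht.
  have [? ?] := bd _ _ pm.1 ht (or_introl nxb).
  by have [? ?] := bd _ _ pm.2 ht (or_introl nxa).
move=> s rs hs; apply: dG => //; apply: ne.
by case: hs => h; [left; rewrite lt_eqF//|left; rewrite gt_eqF//|right; rewrite lt_eqF//|right; rewrite gt_eqF//];
  clear -h dl0; lra.
Qed.

(* In the variable s only one preimage of z must lie in the open strip
   |Im s| < pi, whence the condition on Im z: it keeps z off the cut. *)
Lemma cauchy_key (R : realType) (f : R[i] -> R[i]) (z : R[i]) (x2 : R) :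
  complex.Im z != 0 -> normc z < expR x2 ->
  (forall w, normc w <= expR x2 -> cdiff f w) ->
  vint (fun s => (f (cexp s) - f z) * (cexp s / (cexp s - z))) x2 (- pi) pi = 0.
Proof.
move=> iz zx df; have p0 := pi_gt0 R.
have z0 : z != 0 by apply: contra iz => /eqP ->.
have nz0 : 0 < normc z by rewrite normc_gt0.
(* At w = z the singularity is removable. The factor w makes H tend to 0 at the origin, which
   corresponds to Re s tending to -oo. *)
pose H (w : R[i]) := (f w - f z) * (w / (w - z)).
pose G (s : R[i]) := H (cexp s).
pose x0 := ln (normc z); pose y0 := carg z; pose s0 := x0 +i* y0.
have Es0 : cexp s0 = z by exact: cexp_clog.
have y0p : `|y0| < pi by exact: normr_carg_lt_pi.
have x02 : x0 < x2 by rewrite -ltr_expR lnK.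
have dH w : w != z -> normc w <= expR x2 -> cdiff H w.
  move=> wz /df hw; apply: (@cdiffM R (fun w => f w - f z) (fun w => w / (w - z))).
    exact: (@cdiffB R f (fun=> f z) w hw (@cdiff_cst R (f z) w)).
  apply: (@cdiffM R id (fun w => (w - z)^-1)); first exact: cdiff_id.
  by apply: (@cdiffV R (fun w => w - z)); [rewrite subr_eq0|exact: cdiff_subc].
have dG s : `|complex.Im s| <= pi -> s != s0 -> complex.Re s <= x2 -> exists d, has_cderiv G s d.
  move=> h1 h2 h3; apply: has_cderiv_comp_cexp; apply: dH.
    by apply: contra h2 => /eqP E; apply/eqP/cexp_inj => //; rewrite E Es0.
  by rewrite normc_cexp ler_expR.
have cG s : `|complex.Im s| <= pi -> s != s0 -> complex.Re s <= x2 -> ccontinuous G s.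
  by move=> h1 h2 h3; have [d] := dG s h1 h2 h3; exact: has_cderiv_ccontinuous.
(* Near z the difference quotient of f is at most 1 + |d|, with d the derivative of f at z, and the
   remaining factor satisfies |w| <= e^x2. Where e^s = z, the value of G is 0. *)
have [B [d1 [B0 d10 HB]]] : exists B d1 : R, [/\ 0 < B, 0 < d1 & forall s,
    complex.Re s <= x2 -> normc (s - s0) < d1 -> normc (G s) <= B].
  have /cdiffP[d hd] : cdiff f z by apply: df; exact: ltW.
  have [del del0 K] := hd 1 ltr01.
  have /cdiffP[d' /has_cderiv_ccontinuous cE] : cdiff (@cexp R) s0 by exact: cdiff_cexp.
  have [d1 d10 Hd1] := cE del del0.
  exists ((1 + normc d) * expR x2), d1; split => //.
    by rewrite mulr_gt0 ?expR_gt0// ltr_pwDl// normc_ge0.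
  move=> s sx /Hd1; rewrite Es0 /G /H => hs.
  have [->|nz] := eqVneq (cexp s) z.
    by rewrite subrr mul0r normc0 mulr_ge0 ?expR_ge0// addr_ge0// normc_ge0.
  have := K _ hs; rewrite mul1r [z + _]addrC subrK => K1.
  have K2 : normc (f (cexp s) - f z) <= (1 + normc d) * normc (cexp s - z).
    have -> : f (cexp s) - f z = (f (cexp s) - f z - d * (cexp s - z)) + d * (cexp s - z) by ring.
    apply: le_trans (le_normcD _ _) _; rewrite normcM; lra.
  have n0 : 0 < normc (cexp s - z) by rewrite normc_gt0 subr_eq0.
  rewrite !normcM normcV mulrCA mulrC.
  apply: ler_pM; rewrite ?mulr_ge0 ?normc_ge0 ?invr_ge0 ?(ltW n0)//.
    by rewrite ler_pdivrMr.
  by rewrite normc_cexp ler_expR.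
have JG x1 : x1 < x0 -> rectint G x1 x2 (- pi) pi = 0.
  move=> x10; apply: (@goursat_removable _ G s0 _ _ _ _ B d1) => //=.
  - by rewrite x10.
  - by rewrite -ltr_norml.
  - move=> s [/andP[_ h1] h2] h3; apply: dG => //; by rewrite ler_norml.
  - move=> s [/andP[_ h1] _]; exact: HB.
have JvG x1 : x1 < x0 -> vint G x2 (- pi) pi = vint G x1 (- pi) pi.
  by move=> /JG; rewrite rectint_cexp => /mulic_eq0.
rewrite -/G; apply: eq0_normc; apply/eqP; rewrite eq_le normc_ge0 andbT.
apply/ler_addgt0Pl => e e0; rewrite addr0.
have [d2 d20 Hd2] : exists2 d2 : R, 0 < d2 & forall w, normc (w - 0) < d2 -> normc (f w - f 0) < 1.
  by apply: (cdiff_ccontinuous (df _ _)) => //; rewrite normc0 expR_ge0.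
(* K bounds |f w - f z| / |w - z| near 0: the numerator is at most 1 + |f 0 - f z|, and |w - z| >=
   |z| / 2 once |w| <= |z| / 2. *)
pose K := (1 + normc (f 0 - f z)) / (normc z / 2).
have K0 : 0 < K by rewrite divr_gt0 ?divr_gt0// ltr_pwDl// normc_ge0.
have HK w : normc w < d2 -> normc w <= normc z / 2 -> normc (H w) <= K * normc w.
  move=> h1 h2; rewrite /H !normcM normcV mulrA mulrAC ler_wpM2r ?normc_ge0//.
  have hq : normc z / 2 <= normc (w - z).
    by rewrite normcB; have := le_normcB z w; lra.
  have q0 : 0 < normc z / 2 by rewrite divr_gt0.
  apply: ler_pM; rewrite ?normc_ge0 ?invr_ge0 ?normc_ge0//.
    have := Hd2 w; rewrite subr0 => /(_ h1) h3.
    have -> : f w - f z = (f w - f 0) + (f 0 - f z) by ring.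
    by rewrite (le_trans (le_normcD _ _))// lerD2r ltW.
  by rewrite lef_pV2 ?posrE// (lt_le_trans q0).
have p4 : 0 < 4 * pi * K by apply: mulr_gt0 => //; apply: mulr_gt0.
have [r [r0 r1 r2 r3]] : exists r : R, [/\ 0 < r, r < d2, r <= normc z / 2 & 4 * pi * K * r <= e].
  exists (Num.min (d2 / 2) (Num.min (normc z / 2) (e / (4 * pi * K)))); split.
  - by rewrite !lt_min !divr_gt0.
  - by rewrite gt_min; apply/orP; left; lra.
  - by rewrite !ge_min lexx orbT.
  - by rewrite mulrC -ler_pdivlMr// !ge_min lexx !orbT.
rewrite (@JvG (ln r)); last by rewrite /x0 ltr_ln ?posrE//; lra.
apply: le_trans (_ : 2 * (K * r) * (pi - - pi) <= _); last by lra.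
apply: cint_bound => [|t|t]; rewrite ?in_itv /=; first by lra.
  move=> ht; apply: ccontinuous_ver; apply: cG; rewrite /= ?ler_norml//.
    by apply/eqP => -[E _]; move: r2; rewrite -[r]lnK ?posrE// E /x0 lnK//; lra.
  by rewrite ltW// (le_lt_trans _ x02)// /x0 ler_ln ?posrE//; lra.
have Er : normc (cexp (ln r +i* t)) = r by rewrite normc_cexp /= lnK.
by move=> _; rewrite -{2}Er; apply: HK; rewrite Er.
Qed.

Lemma path_continuous_circle (R : realType) (H : R[i] -> R[i]) (x t : R) :
  (forall w, normc w = expR x -> cdiff H w) ->
  path_continuous (fun t => H (cexp (x +i* t))) t.
Proof.
move=> h; apply: (@ccontinuous_ver _ (fun s => H (cexp s))).
have [|d] := @has_cderiv_comp_cexp R H (x +i* t); last by exact: has_cderiv_ccontinuous.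
by apply: h; rewrite normc_cexp.
Qed.

Lemma cdiff_divsub (R : realType) (z w : R[i]) : w != z -> cdiff (fun w => w / (w - z)) w.
Proof.
move=> wz; apply: (@cdiffM R id (fun w => (w - z)^-1)); first exact: cdiff_id.
by apply: (@cdiffV R (fun w => w - z)); [rewrite subr_eq0|exact: cdiff_subc].
Qed.

(** f(w) = (f(w) - f(z)) + f(z): [cauchy_key] removes the first part and [winding] integrates the
    second. *)
Lemma cauchy_formula (R : realType) (f : R[i] -> R[i]) (z : R[i]) (x : R) :
  complex.Im z != 0 -> normc z < expR x ->
  (forall w, normc w <= expR x -> cdiff f w) ->
  vint (fun s => f (cexp s) * (cexp s / (cexp s - z))) x (- pi) pi = f z * (2 * pi)%:C.
Proof.
move=> iz zx df; have := cauchy_key iz zx df; rewrite /vint => E0.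
have dq w : normc w = expR x -> cdiff (fun w => w / (w - z)) w.
  by move=> wx; apply: cdiff_divsub; apply: contraTneq zx => <-; rewrite wx ltxx.
rewrite -(winding zx) /vint -cintZ; last first.
  by move=> t _; apply: (@path_continuous_circle _ (fun w => w / (w - z))).
apply/eqP; rewrite -subr_eq0 -cintB; last 2 first.
- move=> t _; apply: (@path_continuous_circle _ (fun w => f w * (w / (w - z)))) => w hw.
  by apply: cdiffM; [apply: df; rewrite hw|exact: dq].
- move=> t _; apply: (@path_continuous_circle _ (fun w => f z * (w / (w - z)))) => w hw.
  by apply: (@cdiffM R (fun=> f z)); [exact: cdiff_cst|exact: dq].
apply/eqP; rewrite -[RHS]E0; apply: eq_cint => t _; ring.
Qed.

(** * Polynomial approximation on discs *)

Lemma expr_small (R : realType) (q e : R) : 0 <= q -> q < 1 -> 0 < e ->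
  exists N : nat, q ^+ N <= e.
Proof.
move=> q0 q1 e0; have qn : `|q| < 1 by rewrite ger0_norm.
have /cvgrPdist_le /(_ e e0)[N _ H] := cvg_expr qn.
exists N; have := H N (leqnn N); rewrite sub0r normrN ger0_norm//.
exact: exprn_ge0.
Qed.

Lemma circle_bounded (R : realType) (f : R[i] -> R[i]) (x : R) :
  (forall w, normc w = expR x -> cdiff f w) ->
  exists2 M : R, 0 <= M & forall t : R, - pi <= t <= pi -> normc (f (cexp (x +i* t))) <= M.
Proof.
move=> df; have p0 := pi_gt0 R.
pose g t := normc (f (cexp (x +i* t))).
have cg : {within `[- pi, pi], continuous g}.
  apply: continuous_in_subspaceT => t _; apply/cvgrPdist_lt => e e0.
  have [d d0 H] := path_continuous_circle t df e0.
  exists d => // u /=; rewrite distrC => /H h; rewrite /g.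
  apply: le_lt_trans h; rewrite ler_norml.
  by rewrite lerNl opprB le_normcB /= normcB le_normcB.
have [|c _ Hc] := @EVT_max R g (- pi) pi _ cg; first by lra.
by exists (g c) => [|t ht]; [exact: normc_ge0|apply: Hc; rewrite in_itv].
Qed.

(** Induction on N through w / (w - z) = 1 + (z / w) (w / (w - z)). This is Taylor's expansion with
    an exact remainder, so no series is exchanged with an integral. *)
Lemma cauchy_expansion (R : realType) (f : R[i] -> R[i]) (x : R) (z : R[i]) (N : nat) :
  complex.Im z != 0 -> normc z < expR x ->
  (forall w, normc w <= expR x -> cdiff f w) ->
  f z * (2 * pi)%:C =
   \sum_(n < N) vint (fun s => f (cexp s) / cexp s ^+ n) x (- pi) pi * z ^+ n +
   vint (fun s => f (cexp s) * ((z / cexp s) ^+ N * (cexp s / (cexp s - z)))) x (- pi) pi.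
Proof.
move=> iz zx df.
have dq w : normc w = expR x -> cdiff (fun w => w / (w - z)) w.
  by move=> wx; apply: cdiff_divsub; apply: contraTneq zx => <-; rewrite wx ltxx.
have nz w : normc w = expR x -> w != 0.
  by rewrite -normc_gt0 => ->; rewrite expR_gt0.
have dX w n : normc w = expR x -> cdiff (fun w => (w ^+ n)^-1) w.
  move=> wx; apply: (@cdiffV R (fun w => w ^+ n)); first by rewrite expf_neq0// nz.
  exact: (@cdiffX R id _ n (@cdiff_id R w)).
elim: N => [|N ih].
  rewrite big_ord0 add0r -(cauchy_formula iz zx df); apply: eq_cint => t _.
  by rewrite expr0 mul1r.
rewrite ih big_ord_recr /= -addrA; congr (_ + _).
rewrite [_ * z ^+ N]mulrC /vint -cintZ; last first.
  move=> t _; apply: (@path_continuous_circle _ (fun w => f w / w ^+ N)) => w hw.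
  by apply: cdiffM; [apply: df; rewrite hw|exact: dX].
have cE n : {in `[- pi, pi], forall t : R, path_continuous (fun t => f (cexp (x +i* t)) * ((z / cexp (x +i* t)) ^+ n *
    (cexp (x +i* t) / (cexp (x +i* t) - z)))) t}.
  move=> t _; apply: (@path_continuous_circle _ (fun w => f w * ((z / w) ^+ n * (w / (w - z))))) => w hw.
  apply: cdiffM; first by apply: df; rewrite hw.
  apply: cdiffM; last exact: dq.
  rewrite (_ : (fun w => _) = (fun w => z ^+ n * (w ^+ n)^-1)); last first.
    by apply/funext => u; rewrite expr_div_n.
  by apply: (@cdiffM R (fun=> z ^+ n)); [exact: cdiff_cst|exact: dX].
apply/eqP; rewrite addrC -subr_eq; apply/eqP; rewrite -cintB; last 2 first.
- exact: cE.
- move=> t _; apply: (@path_continuous_circle _ (fun w => z ^+ N * (f w / w ^+ N))) => w hw.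
  apply: (@cdiffM R (fun=> z ^+ N)); first exact: cdiff_cst.
  by apply: cdiffM; [apply: df; rewrite hw|exact: dX].
apply: eq_cint => t _.
have hn : cexp (x +i* t) != 0 by exact: cexp_neq0.
have hz : cexp (x +i* t) - z != 0.
  rewrite subr_eq0; apply: contraTneq zx => <-; by rewrite normc_cexp /= ltxx.
have hN : cexp (x +i* t) ^+ N != 0 by rewrite expf_neq0.
by rewrite !exprS !expr_div_n; field; rewrite hz hN hn.
Qed.

(** The witness is a Taylor polynomial at 0. Its coefficients are integrals over the circle that do
    not involve z, so one polynomial serves the whole disc, and the remainder decays like (rho /
    r)^N. *)
Lemma poly_approx_off_real (R : realType) (f : R[i] -> R[i]) (rho x e : R) :
  0 <= rho -> rho < expR x -> 0 < e ->
  (forall w, normc w <= expR x -> cdiff f w) ->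
  exists p : {poly R[i]}, forall z, complex.Im z != 0 -> normc z <= rho ->
    normc (f z - p.[z]) <= e.
Proof.
move=> rho0 rhox e0 df; have p0 := pi_gt0 R.
have [|M M0 HM] := @circle_bounded R f x.
  by move=> w hw; apply: df; rewrite hw.
pose r := expR x; have r0 : 0 < r := expR_gt0 x.
have D0 : 0 < r - rho by rewrite subr_gt0.
(* M bounds f on the circle, r / (r - rho) bounds |w / (w - z)|, and the 2 is that of [cint_bound].
   The length 2 pi of the segment cancels against the denominator of the coefficients. Dividing e by
   C + 1 covers C = 0. *)
pose C := 2 * (M * (r / (r - rho))).
have C0 : 0 <= C by rewrite /C mulr_ge0// mulr_ge0// divr_ge0// ltW.
have [|||N HN] := @expr_small R (rho / r) (e / (C + 1)).
- by rewrite divr_ge0// ltW.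
- by rewrite ltr_pdivrMr// mul1r.
- by rewrite divr_gt0// ltr_wpDl.
pose J n : R[i] := vint (fun s => f (cexp s) / cexp s ^+ n) x (- pi) pi.
exists (\poly_(n < N) (J n / (2 * pi)%:C)) => z iz zr.
have zx : normc z < expR x by exact: le_lt_trans rhox.
have k0 : (2 * pi)%:C != 0 :> R[i].
  by rewrite -normc_gt0 normc_real normr_gt0 gt_eqF// mulr_gt0.
have E := cauchy_expansion N iz zx df.
rewrite horner_poly.
have -> : \sum_(i < N) J i / (2 * pi)%:C * z ^+ i =
    (\sum_(i < N) J i * z ^+ i) / (2 * pi)%:C.
  by rewrite mulr_suml; apply: eq_bigr => i _; rewrite mulrAC.
rewrite -[f z](mulfK k0) -mulrBl E addrAC subrr add0r.
rewrite normcM normcV normc_real [`|2 * pi|]gtr0_norm ?mulr_gt0//.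
rewrite ler_pdivrMr ?mulr_gt0//.
have hb : 2 * (M * ((rho / r) ^+ N * (r / (r - rho)))) * (pi - - pi) <= e * (2 * pi).
  have -> : 2 * (M * ((rho / r) ^+ N * (r / (r - rho)))) * (pi - - pi) =
     (rho / r) ^+ N * C * (2 * pi) by rewrite /C; ring.
  rewrite ler_pM2r ?mulr_gt0//.
  apply: le_trans (_ : e / (C + 1) * C <= _); first by rewrite ler_wpM2r.
  rewrite mulrAC ler_pdivrMr ?ltr_wpDl// ler_pM2l//; lra.
apply: le_trans hb; apply: cint_bound; first by lra.
  move=> t _; apply: (@path_continuous_circle _ (fun w => f w * ((z / w) ^+ N * (w / (w - z))))) => w hw.
  have w0 : w != 0 by rewrite -normc_gt0 hw expR_gt0.
  apply: cdiffM; first by apply: df; rewrite hw.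
  apply: cdiffM.
    apply: (@cdiffX R (fun w => z / w)); apply: (@cdiffM R (fun=> z)); first exact: cdiff_cst.
    by apply: (@cdiffV R id) => //; exact: cdiff_id.
  by apply: cdiff_divsub; apply: contraTneq zx => <-; rewrite hw ltxx.
move=> t; rewrite in_itv /= => ht.
have hr : normc (cexp (x +i* t)) = r by rewrite normc_cexp.
rewrite !normcM normcX normcM !normcV hr.
apply: ler_pM; rewrite ?mulr_ge0 ?exprn_ge0 ?mulr_ge0 ?invr_ge0 ?normc_ge0 ?(ltW r0)//.
  exact: HM.
apply: ler_pM; rewrite ?exprn_ge0 ?mulr_ge0 ?invr_ge0 ?normc_ge0 ?(ltW r0)//.
  by apply: lerXn2r; rewrite ?nnegrE ?divr_ge0 ?normc_ge0 ?(ltW r0)// ler_wpM2r// invr_ge0 ltW.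
rewrite ler_wpM2l ?(ltW r0)// lef_pV2 ?posrE//.
  have := le_normcB (cexp (x +i* t)) z; rewrite hr; lra.
by have := le_normcB (cexp (x +i* t)) z; rewrite hr; lra.
Qed.

(** A real z is replaced by z + it with t small: the estimate holds there, and continuity of f - p
    brings it back to z at the cost of e / 2. *)
Lemma poly_approx0 (R : realType) (f : R[i] -> R[i]) (rho1 rho e : R) :
  0 < rho1 -> rho1 < rho -> 0 < e ->
  (forall w, normc w < rho -> cdiff f w) ->
  exists p : {poly R[i]}, forall z, normc z <= rho1 -> normc (f z - p.[z]) <= e.
Proof.
move=> r10 r1r e0 df.
(* rho1 < r2 < r3 < rho: the gap up to r2 leaves room for the shift by it, and r3 is the radius of
   the contour. *)
pose r2 := (2 * rho1 + rho) / 3; pose r3 := (rho1 + 2 * rho) / 3.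
have r30 : 0 < r3 by rewrite /r3; lra.
have Er3 : expR (ln r3) = r3 by rewrite lnK.
have e2 : 0 < e / 2 by rewrite divr_gt0.
have [||||p Hp] := @poly_approx_off_real R f r2 (ln r3) (e / 2).
- by rewrite /r2; lra.
- by rewrite Er3 /r2 /r3; lra.
- by [].
- by move=> w hw; apply: df; rewrite (le_lt_trans hw)// Er3 /r3; lra.
exists p => z zr.
have [iz|iz] := eqVneq (complex.Im z) 0; last first.
  apply: le_trans (Hp z iz _) _; [rewrite /r2; lra|lra].
have cf : ccontinuous (fun w => f w - p.[w]) z.
  apply: cdiff_ccontinuous; apply: (@cdiffB R f (fun w => p.[w])).
    by apply: df; exact: le_lt_trans r1r.
  exact: (@cdiff_horner R p id z (@cdiff_id R z)).
have [d d0 Hd] := cf _ e2.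
pose t := Num.min (d / 2) (r2 - rho1).
have t0 : 0 < t by rewrite lt_min divr_gt0//= /r2; lra.
have nt : normc (0 +i* t) = t by rewrite /= expr0n add0r sqrtr_sqr gtr0_norm.
have td : t < d by rewrite gt_min; apply/orP; left; lra.
have tr : t <= r2 - rho1 by rewrite ge_min lexx orbT.
have := Hd (z + (0 +i* t)); rewrite addrAC subrr add0r nt => /(_ td) h1.
have h2 : normc (f (z + (0 +i* t)) - p.[z + (0 +i* t)]) <= e / 2.
  apply: Hp; first by rewrite Im_add iz /= add0r gt_eqF.
  by rewrite (le_trans (le_normcD _ _))// nt; lra.
rewrite normcB in h1.
have := le_normcB (f z - p.[z]) (f (z + (0 +i* t)) - p.[z + (0 +i* t)]).
lra.
Qed.

Lemma holomorphic_poly_approx (R : realType) (f : R[i] -> R[i]) (c : R[i]) (rho1 rho e : R) :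
  0 < rho1 -> rho1 < rho -> 0 < e ->
  (forall w, normc (w - c) < rho -> cdiff f w) ->
  exists p : {poly R[i]}, forall z, normc (z - c) <= rho1 -> normc (f z - p.[z]) <= e.
Proof.
move=> r10 r1r e0 df.
have [||||p Hp] := @poly_approx0 R (fun w => f (w - - c)) rho1 rho e => //.
  move=> w hw; apply: (@cdiff_comp R f (fun w => w - - c)); first exact: cdiff_subc.
  by apply: df; rewrite opprK addrK.
exists (p \Po ('X - c%:P)) => z /Hp.
by rewrite opprK subrK horner_comp !hornerE.
Qed.

(** * The Bergman norm *)

Definition open2 {R : realType} (U : set (R * R)) := forall p, U p ->
  exists2 d : R, 0 < d & forall q, `|q.1 - p.1| < d -> `|q.2 - p.2| < d -> U q.

Lemma ltr_natSinv (R : realType) (e : R) : 0 < e -> exists n : nat, n.+1%:R^-1 < e.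
Proof.
move=> e0; exists (Num.bound e^-1).
have h : e^-1 < (Num.bound e^-1).+1%:R.
  by rewrite (lt_trans (archi_boundP _)) ?invr_ge0 ?ltW// ltr_nat.
by rewrite invf_plt ?posrE// ltr0n.
Qed.

(** U is the union of the countably many boxes with rational centre and half-side 1 / (n + 1) that
    it contains. *)
Lemma open2_measurable (R : realType) (U : set (R * R)) : open2 U -> measurable U.
Proof.
move=> oU.
pose box (i : rat * rat * nat) : set (R * R) :=
  [set x | ratr i.1.1 - i.2.+1%:R^-1 < x < ratr i.1.1 + i.2.+1%:R^-1] `*`
  [set x | ratr i.1.2 - i.2.+1%:R^-1 < x < ratr i.1.2 + i.2.+1%:R^-1].
have mI (a b : R) : measurable [set x : R | a < x < b].
  by have := @measurable_itv R `]a, b[; rewrite set_itvoo.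
pose F i := if pselect (box i `<=` U) then box i else set0.
have -> : U = \bigcup_(i in setT) F i.
  apply/seteqP; split => [p Up|p [i _]]; last first.
    by rewrite /F; case: pselect => //; exact.
  case: p Up => u v Up; have [d d0 H] := oU _ Up; rewrite /= in H.
  (* The centre is within 1 / (n + 1) of the point and the box has the same half-side, so the box
     stays within 2 / (n + 1) < d of it. *)
  have [n hn] := ltr_natSinv (divr_gt0 d0 (ltr0Sn R 1)).
  have n0 : 0 < n.+1%:R^-1 :> R by rewrite invr_gt0 ltr0n.
  have [q1 hq1] : exists q, ratr q \in `]u - n.+1%:R^-1, u + n.+1%:R^-1[.
    by apply: rat_in_itvoo; rewrite ltrBlDr -addrA ltrDl addr_gt0.
  have [q2 hq2] : exists q, ratr q \in `]v - n.+1%:R^-1, v + n.+1%:R^-1[.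
    by apply: rat_in_itvoo; rewrite ltrBlDr -addrA ltrDl addr_gt0.
  move: hq1 hq2; rewrite !in_itv /= => hq1 hq2.
  move: n0 hn hq1 hq2; set k := n.+1%:R^-1 => n0 hn hq1 hq2.
  exists (q1, q2, n) => //; rewrite /F; case: pselect => /=.
    by move=> _; split => /=; rewrite -/k; lra.
  case=> -[u' v'] [/=]; rewrite -/k => hu hv; apply: H => /=; rewrite ltr_norml; lra.
apply: countable_bigcupT_measurable => //.
move=> i; rewrite /F; case: pselect => [?|?]; last exact: measurable0.
by apply: measurableX; exact: mI.
Qed.

Definition cont2 {R : realType} (h : R * R -> R) (p : R * R) :=
  forall e : R, 0 < e -> exists2 d : R, 0 < d &
    forall q, `|q.1 - p.1| < d -> `|q.2 - p.2| < d -> `|h q - h p| < e.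

Lemma cont2_measurable (R : realType) (U : set (R * R)) (h : R * R -> R) :
  open2 U -> (forall p, U p -> cont2 h p) -> measurable_fun U h.
Proof.
move=> oU ch; move=> mU; apply: (measurability _ (RGenOInfty.measurableE R)) => //.
move=> _ [_ [a ->] <-]; apply: open2_measurable => p [Up].
rewrite /= in_itv /= andbT => hp.
have [d1 d10 H1] := oU _ Up.
have hp0 : 0 < h p - a by rewrite subr_gt0.
have [d2 d20 H2] := ch _ Up _ hp0.
exists (Num.min d1 d2); first by rewrite lt_min d10.
move=> q; rewrite !lt_min => /andP[a1 a2] /andP[b1 b2].
split; first exact: H1.
by rewrite /= in_itv /= andbT; have := H2 q a2 b2; rewrite ltr_norml => /andP[]; lra.
Qed.

Lemma ccontinuous_cont2 (R : realType) (f : R[i] -> R[i]) (p : R * R) : ccontinuous f (toC p) ->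
  cont2 (fun q => normc (f (toC q)) ^+ 2) p.
Proof.
move=> cf e e0.
(* |A^2 - B^2| = |A - B| (A + B), and A + B <= 2 B + 1 = M as soon as |A - B| < 1. *)
pose M := 2 * normc (f (toC p)) + 1.
have n0 := normc_ge0 (f (toC p)).
have M0 : 0 < M by rewrite /M; lra.
have e1 : 0 < Num.min 1 (e / M) by rewrite lt_min ltr01 divr_gt0.
have [d d0 H] := cf _ e1.
exists (d / 2) => [|q h1 h2]; first by rewrite divr_gt0.
have hq : normc (toC q - toC p) < d.
  rewrite (le_lt_trans (normc_le_ReIm _))// (splitr d) ltrD//.
have := H _ hq; rewrite lt_min => /andP[k1 k2] {H}.
pose A := normc (f (toC q)); pose B := normc (f (toC p)); rewrite -/A -/B.
rewrite -/B in n0.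
have kAB : `|A - B| <= normc (f (toC q) - f (toC p)).
  rewrite ler_norml le_normcB andbT lerNl opprB normcB.
  exact: le_normcB.
rewrite subr_sqr normrM.
have A0 : 0 <= A := normc_ge0 _.
have : `|A - B| < 1 by rewrite (le_lt_trans kAB).
rewrite ltr_norml => hAB.
have k3 : `|A - B| < e / M by rewrite (le_lt_trans kAB).
apply: le_lt_trans (_ : `|A - B| * M < _); last by rewrite -ltr_pdivlMr.
by rewrite ler_wpM2l// ger0_norm ?addr_ge0// /M -/B; lra.
Qed.

Lemma open2_disc (R : realType) (c : R[i]) (r : R) :
  open2 [set p : R * R | normc (toC p - c) < r].
Proof.
move=> p hp; rewrite /mkset in hp.
have d0 : 0 < (r - normc (toC p - c)) / 2 by rewrite divr_gt0// subr_gt0.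
exists ((r - normc (toC p - c)) / 2) => // q h1 h2; rewrite /mkset.
have -> : toC q - c = (toC q - toC p) + (toC p - c) by ring.
rewrite (le_lt_trans (le_normcD _ _))//.
have h3 : normc (toC q - toC p) <= `|q.1 - p.1| + `|q.2 - p.2| := normc_le_ReIm _.
by rewrite -ltrBrDr (le_lt_trans h3)// (splitr (r - _)) ltrD.
Qed.

Lemma open2_Delta (R : realType) : open2 (toC @^-1` Delta R).
Proof.
rewrite (_ : _ @^-1` _ = [set p : R * R | normc (toC p - 1) < 1]).
  exact: open2_disc.
by apply/seteqP; split => p /Delta_normc.
Qed.

Lemma measurable_Delta (R : realType) : measurable (toC @^-1` Delta R).
Proof. apply: open2_measurable; exact: (@open2_Delta R). Qed.

Lemma measurable_sqmod (R : realType) (f : R[i] -> R[i]) :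
  (forall z, Delta R z -> ccontinuous f z) -> measurable_fun (toC @^-1` Delta R) (sqmod f).
Proof.
move=> cf; apply/measurable_EFinP; apply: cont2_measurable; first exact: (@open2_Delta R).
by move=> p hp; apply: ccontinuous_cont2; exact: cf.
Qed.

(** * The area integral under dilations *)

Lemma preimage_affine_itv (R : realType) (r k a b : R) : 0 < r ->
  (fun x : R => r * x + k) @^-1` `]a, b] = `](a - k) / r, (b - k) / r]%classic.
Proof.
move=> r0; apply/seteqP; split => x /=; rewrite !in_itv /= ltr_pdivrMr// ler_pdivlMr// => /andP[h1 h2]; apply/andP; split; lra.
Qed.

Lemma measurable_affine (R : realType) (r k : R) :
  measurable_fun [set: R] (fun x : R => r * x + k : measurableTypeR R).
Proof. by apply: measurable_funD => //; apply: measurable_funM. Qed.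

(** By uniqueness of Lebesgue measure: r times the pushforward agrees with it on half-open
    intervals. *)
Lemma lebesgue_measure_affine (R : realType) (r k : R) (A : set R) : 0 < r -> measurable A ->
  (@lebesgue_measure R A = r%:E * @lebesgue_measure R ((fun x : R => (r * x + k)%R) @^-1` A))%E.
Proof.
move=> r0 mA.
pose phi : R -> measurableTypeR R := fun x => r * x + k.
pose mphi : measurable_fun [set: R] phi := @measurable_affine R r k.
have /(_ mphi) H := @lebesgue_measure_unique R
  (mscale (NngNum (ltW r0)) (pushforward (@lebesgue_measure R) phi)).
rewrite H// => _ [[u v]] _ <-.
transitivity (r%:E * @lebesgue_measure R (phi @^-1` `]u, v]))%E; last by [].
have -> : phi @^-1` `]u, v] = `](u - k) / r, (v - k) / r]%classic by exact: preimage_affine_itv.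
rewrite !lebesgue_measure_itv /= !lte_fin.
rewrite ltr_pM2r ?invr_gt0// ltrD2r.
case: ifPn => _; last by rewrite mule0.
by rewrite -!EFinB -EFinM; congr (_%:E); field; exact: lt0r_neq0.
Qed.

(** For k = 1 - r, this is the dilation of ratio r about the point 1. *)
Definition scale2 {R : realType} (r k : R) (p : R * R) : R * R :=
  (r * p.1 + k, r * p.2).

Lemma measurable_scale2 (R : realType) (r k : R) :
  measurable_fun [set: R * R] (@scale2 R r k).
Proof.
apply/measurable_fun_pairP; split.
  by apply: (measurableT_comp (measurable_affine r k)).
apply: measurable_funM => //.
Qed.

(** By uniqueness of the product measure it is enough to compare on products of measurable sets,
    where each coordinate contributes a factor r. *)
Lemma dA_scale2 (R : realType) (r k : R) (A : set (measurableTypeR R * measurableTypeR R)) :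
  0 < r -> measurable A ->
  (dA R A = (r ^+ 2)%:E * dA R (scale2 r k @^-1` A))%E.
Proof.
move=> r0 mA.
pose phi : measurableTypeR R * measurableTypeR R -> measurableTypeR R * measurableTypeR R := scale2 r k.
have mphi : measurable_fun setT phi := @measurable_scale2 R r k.
have /(_ mphi) H := @product_measure_unique _ _ _ _ R (@lebesgue_measure R)
  (@lebesgue_measure R) (mscale (NngNum (sqr_ge0 r))
  (pushforward (@lebesgue_measure R \x @lebesgue_measure R)%E phi)).
rewrite /dA H// => B C mB mC.
transitivity ((r ^+ 2)%:E * (@lebesgue_measure R \x @lebesgue_measure R)%E (phi @^-1` (B `*` C)))%E; first by [].
have -> : phi @^-1` (B `*` C) =
   ((fun x : R => r * x + k) @^-1` B) `*` ((fun x : R => r * x + 0) @^-1` C).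
  by apply/seteqP; split => -[x y] /=; rewrite /phi /scale2 /= addr0.
have mpre l (D : set (measurableTypeR R)) : measurable D ->
    measurable ((fun x : R => r * x + l) @^-1` D : set (measurableTypeR R)).
  by move=> mD; have := @measurable_affine R r l measurableT D mD; rewrite setTI.
rewrite [X in (_ * X)%E]product_measure1E; [|exact: mpre|exact: mpre].
have EB := lebesgue_measure_affine k r0 mB; have EC := lebesgue_measure_affine 0 r0 mC.
have K (x y X Y : \bar R) : (x = r%:E * X -> y = r%:E * Y -> (r ^+ 2)%:E * (X * Y) = x * y)%E.
  by move=> -> ->; rewrite muleACA -EFinM.
exact: K EB EC.
Qed.

Lemma ge0_integral_scale2 (R : realType) (r k : R)
    (D : set (measurableTypeR R * measurableTypeR R))
    (h : measurableTypeR R * measurableTypeR R -> \bar R) : 0 < r ->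
  measurable D -> measurable_fun D h -> (forall p, D p -> (0 <= h p)%E) ->
  (\int[dA R]_(p in D) h p =
   (r ^+ 2)%:E * \int[dA R]_(p in scale2 r k @^-1` D) h (scale2 r k p))%E.
Proof.
move=> r0 mD mh h0.
pose phi : measurableTypeR R * measurableTypeR R -> measurableTypeR R * measurableTypeR R := scale2 r k.
have mphi : measurable_fun setT phi := @measurable_scale2 R r k.
pose pm : {measure set (measurableTypeR R * measurableTypeR R) -> \bar R} :=
  measure_function_pushforward__canonical__measure_function_Measure (dA R) mphi.
have h0' : {in D, forall y, (0 <= h y)%E} by move=> p /set_mem; exact: h0.
have E : (\int[pm]_(p in D) h p = \int[dA R]_(p in phi @^-1` D) h (phi p))%E.
  exact: (ge0_integral_pushforward mphi (dA R) mD mh h0').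
have M := ge0_integral_mscale pm mD (NngNum (sqr_ge0 r)) mh h0.
rewrite E in M; rewrite -[RHS]M.
apply: eq_measure_integral => A mA _.
exact: (dA_scale2 k r0 mA).
Qed.

Notation plane R := (measurableTypeR R * measurableTypeR R)%type.

Definition Delta2 (R : realType) : set (plane R) := toC @^-1` Delta R.
Arguments Delta2 R : clear implicits.

Lemma measurable_Delta2 (R : realType) : measurable (Delta2 R).
Proof. exact: measurable_Delta. Qed.

Definition Delta_continuous {R : realType} (f : R[i] -> R[i]) := forall z, Delta R z -> ccontinuous f z.

Lemma measurable_sqmod_Delta2 (R : realType) (f : R[i] -> R[i]) : Delta_continuous f ->
  measurable_fun (Delta2 R) (sqmod f : plane R -> \bar R).
Proof. move=> cf; exact: (measurable_sqmod cf). Qed.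

Lemma Delta_continuousB (R : realType) (f g : R[i] -> R[i]) : Delta_continuous f -> Delta_continuous g ->
  Delta_continuous (fun z => f z - g z).
Proof. by move=> cf cg z hz; apply: ccontinuousB; [exact: cf|exact: cg]. Qed.

(** The square of the norm: the triangle inequality becomes a pointwise inequality with factors 2,
    and the square root is taken only at the very end. *)
Definition sqnorm {R : realType} (f : R[i] -> R[i]) : \bar R :=
  (\int[dA R]_(p in Delta2 R) sqmod f p)%E.

Lemma sqnorm_ge0 (R : realType) (f : R[i] -> R[i]) : (0 <= sqnorm f)%E.
Proof. by apply: integral_ge0 => p _; rewrite lee_fin sqr_ge0. Qed.

Lemma sqnorm_le (R : realType) (f g : R[i] -> R[i]) : Delta_continuous f -> Delta_continuous g ->
  (forall z, Delta R z -> normc (f z) <= normc (g z)) -> (sqnorm f <= sqnorm g)%E.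
Proof.
move=> cf cg fg; apply: ge0_le_integral.
- exact: measurable_Delta2.
- by move=> p _; rewrite lee_fin sqr_ge0.
- exact: measurable_sqmod_Delta2.
- exact: measurable_sqmod_Delta2.
- by move=> p hp; rewrite lee_fin lerXn2r ?nnegrE ?normc_ge0//; exact: fg.
Qed.

Lemma eq_sqnorm (R : realType) (f g : R[i] -> R[i]) :
  (forall z, Delta R z -> normc (f z) = normc (g z)) -> sqnorm f = sqnorm g.
Proof.
by move=> fg; apply: eq_integral => p /set_mem hp; rewrite /sqmod fg.
Qed.

Lemma sqr_normcD_le (R : realType) (x y : R[i]) :
  normc (x + y) ^+ 2 <= 2 * normc x ^+ 2 + 2 * normc y ^+ 2.
Proof.
have := le_normcD x y; have := normc_ge0 (x + y); have := normc_ge0 x; have := normc_ge0 y.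
move: (normc (x + y)) (normc x) (normc y) => s u v v0 u0 s0 h.
have : s ^+ 2 <= (u + v) ^+ 2 by rewrite lerXn2r ?nnegrE ?addr_ge0.
have := sqr_ge0 (u - v); rewrite sqrrB sqrrD; lra.
Qed.

Lemma sqnorm_triangle (R : realType) (f g h : R[i] -> R[i]) :
  Delta_continuous f -> Delta_continuous g -> Delta_continuous h ->
  (sqnorm (fun z => (f z - h z)%R) <=
   2%:E * sqnorm (fun z => (f z - g z)%R) + 2%:E * sqnorm (fun z => (g z - h z)%R))%E.
Proof.
move=> cf cg ch.
have m1 := measurable_sqmod_Delta2 (Delta_continuousB cf cg);
have m2 := measurable_sqmod_Delta2 (Delta_continuousB cg ch);
have m3 := measurable_sqmod_Delta2 (Delta_continuousB cf ch).
rewrite /sqnorm -!ge0_integralZl_EFin //; try by [exact: measurable_Delta2|move=> p _; rewrite lee_fin sqr_ge0].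
rewrite -ge0_integralD.
- apply: ge0_le_integral.
  + exact: measurable_Delta2.
  + by move=> p _; rewrite lee_fin sqr_ge0.
  + exact: m3.
  + by apply: emeasurable_funD; apply: measurable_funeM.
  + move=> p _; rewrite /sqmod -!EFinM -EFinD lee_fin.
    have -> : f (toC p) - h (toC p) = (f (toC p) - g (toC p)) + (g (toC p) - h (toC p)) by ring.
    exact: sqr_normcD_le.
- exact: measurable_Delta2.
- by move=> p _; rewrite mule_ge0// lee_fin sqr_ge0.
- exact: measurable_funeM.
- by move=> p _; rewrite mule_ge0// lee_fin sqr_ge0.
- exact: measurable_funeM.
Qed.

Lemma Delta_dil (R : realType) (r : R) (z : R[i]) : 0 < r -> r <= 1 ->
  Delta R z -> Delta R (1 + r%:C * (z - 1)).
Proof.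
move=> r0 r1 /Delta_normc h; apply/Delta_normc.
rewrite addrAC subrr add0r normcM normc_real gtr0_norm//.
apply: le_lt_trans h; by rewrite -[leRHS]mul1r; apply: ler_wpM2r => //; exact: normc_ge0.
Qed.

(** The dilation has Jacobian r^2 and maps Delta onto the disc of radius r about 1, which lies in
    Delta. *)
Lemma sqnorm_dil (R : realType) (f : R[i] -> R[i]) (r : R) : Delta_continuous f -> 0 < r -> r <= 1 ->
  (sqnorm (fun z => f (1 + r%:C * (z - 1))%R) <= (r ^- 2)%:E * sqnorm f)%E.
Proof.
move=> cf r0 r1.
pose D' : set (plane R) := [set p | normc (toC p - 1) < r].
have D'D : D' `<=` Delta2 R.
  by move=> p hp; apply/Delta_normc; exact: lt_le_trans r1.
have mD' : measurable D' by apply: open2_measurable; exact: open2_disc.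
have mf : measurable_fun D' (sqmod f : plane R -> \bar R).
  by apply: measurable_funS (measurable_sqmod_Delta2 cf) => //; exact: measurable_Delta2.
have s0 p : D' p -> (0 <= sqmod f p)%E by move=> _; rewrite lee_fin sqr_ge0.
have E := ge0_integral_scale2 (1 - r) r0 mD' mf s0.
have tC p : toC (scale2 r (1 - r) p) = 1 + r%:C * (toC p - 1).
  case: p => x y; rewrite /toC /scale2 /= /real_complex_def /=.
  by rewrite (_ : (1 : R[i]) = 1 +i* 0)// subcE mulcE addcE; congr (_ +i* _); ring.
have pre : scale2 r (1 - r) @^-1` D' = Delta2 R.
  have dn p : normc (toC (scale2 r (1 - r) p) - 1) = r * normc (toC p - 1).
    by rewrite tC addrAC subrr add0r normcM normc_real gtr0_norm.
  apply/seteqP; split => p; rewrite /D' /preimage /mkset dn.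
    by move=> h; apply/Delta_normc; rewrite -(ltr_pM2l r0) mulr1.
  by move=> /Delta_normc h; rewrite -[ltRHS]mulr1 ltr_pM2l.
have -> : (sqnorm (fun z => f (1 + r%:C * (z - 1))%R) =
    (r ^- 2)%:E * \int[dA R]_(p in D') sqmod f p)%E.
  rewrite E pre muleA -EFinM mulVf ?mul1e ?expf_neq0 ?gt_eqF//.
  by apply: eq_integral => p _; rewrite /sqmod tC.
apply: lee_wpmul2l; first by rewrite lee_fin invr_ge0 sqr_ge0.
apply: ge0_subset_integral => //.
- exact: measurable_Delta2.
- exact: measurable_sqmod_Delta2.
- by move=> p _; rewrite lee_fin sqr_ge0.
Qed.

Lemma ccontinuous_comp (R : realType) (f g : R[i] -> R[i]) (z : R[i]) :
  ccontinuous g z -> ccontinuous f (g z) -> ccontinuous (fun z => f (g z)) z.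
Proof.
move=> cg cf e /cf[d d0 H]; have [d' d'0 H'] := cg _ d0.
by exists d' => // t /H' /H.
Qed.

Lemma Delta_continuous_dil (R : realType) (f : R[i] -> R[i]) (r : R) : Delta_continuous f -> 0 < r -> r <= 1 ->
  Delta_continuous (fun z => f (1 + r%:C * (z - 1))).
Proof.
move=> cf r0 r1 z hz; apply: (@ccontinuous_comp R f (fun z => 1 + r%:C * (z - 1))).
  exact: ccontinuous_affine.
by apply: cf; exact: Delta_dil.
Qed.

Lemma limn_einf_le (R : realType) (u : (\bar R)^nat) (c : \bar R) :
  (forall n, (u n <= c)%E) -> (limn_einf u <= c)%E.
Proof.
move=> uc; rewrite limn_einf_lim; apply: lime_le; first exact: is_cvg_einfs.
by apply: nearW => n; apply: le_trans (uc n); apply: ereal_inf_lbound; exists n => /=.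
Qed.

(* Fatou's lemma applied to 2 |f_r|^2 + 2 |f|^2 - |f_r - f|^2, whose pointwise
   limit is 4 |f|^2, while the integral of 2 |f_r|^2 is at most 2 r^-2 ||f||^2. *)
Lemma dil_approx (R : realType) (f : R[i] -> R[i]) (e : R) : Delta_continuous f ->
  (sqnorm f < +oo)%E -> 0 < e ->
  exists r : R, [/\ 0 < r, r < 1 &
    (sqnorm (fun z => f (1 + r%:C * (z - 1)) - f z)%R < e%:E)%E].
Proof.
move=> cf ffin e0.
have [A A0 EA] : exists2 A : R, 0 <= A & sqnorm f = A%:E.
  have := sqnorm_ge0 f; case: (sqnorm f) ffin => // A _; rewrite lee_fin => A0; by exists A.
(* With r^-2 <= 1 + 8 t, the sum 2 r^-2 A + 2 A is at most 4 A + 16 t A; the condition t 32 (A + 1)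
   < e keeps the excess below e / 2. The offset N in the index of [t] makes this hold for every
   n. *)
have k0 : 0 < 32 * (A + 1) by lra.
have [N hN] := ltr_natSinv (divr_gt0 e0 k0).
pose t n : R := ((n + N).+2)%:R^-1.
have t0 n : 0 < t n by rewrite invr_gt0 ltr0n.
have t2 n : t n <= 1 / 2.
  by rewrite /t mul1r lef_pV2 ?posrE ?ltr0n// ler_nat.
have tN n : t n * (32 * (A + 1)) < e.
  rewrite -ltr_pdivlMr//; apply: le_lt_trans hN.
  by rewrite lef_pV2 ?posrE ?ltr0n// ler_nat ltnS (leq_trans (leq_addl n N)).
have tcv d : 0 < d -> \forall n \near \oo, t n < d.
  move=> /ltr_natSinv[m hm]; exists m => // n /= mn; apply: le_lt_trans hm.
  by rewrite lef_pV2 ?posrE ?ltr0n// ler_nat ltnS (leq_trans mn)// (leq_trans (leq_addr N n)).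
pose r n := 1 - t n.
have r0 n : 0 < r n by have := t2 n; rewrite /r; lra.
have r1 n : r n < 1 by have := t0 n; rewrite /r; lra.
pose F n z := f (1 + (r n)%:C * (z - 1)).
have cF n : Delta_continuous (F n) by apply: Delta_continuous_dil => //; exact: ltW.
(* If every f_r stayed at squared distance at least e from f, the integrals of g n would be at most
   4 A - e / 2, while Fatou's lemma requires 4 A. *)
apply: contrapT => H.
have HN n : (e%:E <= sqnorm (fun z => (F n z - f z)%R))%E.
  by rewrite leNgt; apply/negP => h; apply: H; exists (r n).
pose g n (p : plane R) : \bar R :=
  (2 * normc (F n (toC p)) ^+ 2 + 2 * normc (f (toC p)) ^+ 2 - normc (F n (toC p) - f (toC p)) ^+ 2)%:E.
have mF n := measurable_sqmod_Delta2 (cF n);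
have mf := measurable_sqmod_Delta2 cf;
have mFf n := measurable_sqmod_Delta2 (Delta_continuousB (cF n) cf).
have mg n : measurable_fun (Delta2 R) (g n).
  have mR h : Delta_continuous h -> measurable_fun (Delta2 R) (fun p : plane R => normc (h (toC p)) ^+ 2).
    by move=> ch; have /measurable_EFinP := measurable_sqmod_Delta2 ch.
  have -> : g n = EFin \o (fun p : plane R =>
    2 * normc (F n (toC p)) ^+ 2 + 2 * normc (f (toC p)) ^+ 2 - normc (F n (toC p) - f (toC p)) ^+ 2) by [].
  apply/measurable_EFinP; apply: measurable_funB; last exact: (mR _ (Delta_continuousB (cF n) cf)).
  by apply: measurable_funD; apply: measurable_funM => //; apply: mR.
have g0 n p : Delta2 R p -> (0 <= g n p)%E.
  move=> _; rewrite lee_fin subr_ge0 (le_trans (sqr_normcD_le _ _))// normcN//.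
have sq0 h (p : plane R) : Delta2 R p -> (0 <= sqmod h p)%E by move=> _; rewrite lee_fin sqr_ge0.
have Ig n : (\int[dA R]_(p in Delta2 R) g n p <= (4 * A - e / 2)%:E)%E.
  have E : (\int[dA R]_(p in Delta2 R) g n p + sqnorm (fun z => (F n z - f z)%R) =
     2%:E * sqnorm (F n) + 2%:E * sqnorm f)%E.
    rewrite /sqnorm -ge0_integralD//; try exact: measurable_Delta2; try exact: mFf;
      try exact: sq0; try exact: g0.
    rewrite -!ge0_integralZl_EFin//; try exact: measurable_Delta2; try exact: sq0; try exact: mf; try exact: mF.
    rewrite -ge0_integralD//; try exact: measurable_Delta2;
      try (by apply: measurable_funeM); try (by move=> p hp; rewrite mule_ge0 ?sq0).
    by apply: eq_integral => p _; rewrite /g /sqmod -!EFinM -!EFinD subrK.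
  have h1 := HN n.
  have h2 : (2%:E * sqnorm (F n) + 2%:E * sqnorm f <= (4 * A + e / 2)%:E)%E.
    rewrite EA -EFinM.
    apply: le_trans (_ : 2%:E * ((r n ^- 2)%:E * A%:E) + (2 * A)%:E <= _)%E.
      apply: leeD => //; apply: lee_wpmul2l => //; rewrite -EA.
      by apply: sqnorm_dil => //; exact: ltW.
    rewrite -!EFinM -EFinD lee_fin.
    have rn2 : r n ^- 2 <= 1 + 8 * t n.
      rewrite -[_ ^- 2]mul1r ler_pdivrMr ?exprn_gt0//.
      have := t2 n; have := t0 n; rewrite /r; move: (t n) => u u0 u2.
      have -> : (1 + 8 * u) * (1 - u) ^+ 2 = 1 + u * (6 - 15 * u + 8 * u ^+ 2) by ring.
      rewrite lerDl mulr_ge0 ?(ltW u0)//.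
      have : 0 <= (2 * u - 1) ^+ 2 by exact: sqr_ge0.
      have -> : (2 * u - 1) ^+ 2 = 4 * u ^+ 2 - 4 * u + 1 by ring.
      by have := sqr_ge0 (u - 1 / 2); lra.
    have h3 : r n ^- 2 * A <= (1 + 8 * t n) * A by rewrite ler_wpM2r.
    have h4 : t n * A <= t n * (A + 1) by rewrite ler_wpM2l ?(ltW (t0 n))//; lra.
    by have := tN n; lra.
  have h3 : (\int[dA R]_(p in Delta2 R) g n p + e%:E <= (4 * A + e / 2)%:E)%E.
    by apply: le_trans h2; rewrite -E; apply: leeD2l.
  rewrite (_ : (4 * A - e / 2)%:E = ((4 * A + e / 2)%:E - e%:E)%E); last first.
    by rewrite -EFinB; congr (_%:E); lra.
  by rewrite leeBrDr.
have gl p : Delta2 R p -> (4%:E * sqmod f p = limn_einf (g ^~ p))%E.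
  move=> hp; set z := toC p.
  have c2 : (fun n => normc (F n z - f z)) @ \oo --> (0 : R).
    apply/cvgrPdist_lt => d d0; have [d1 d10 Hd] := cf z hp _ d0.
    have zz0 : 0 < normc (z - 1) + 1 by rewrite ltr_wpDl// normc_ge0.
    near=> n; rewrite sub0r normrN ger0_norm ?normc_ge0//; apply: Hd.
    have -> : 1 + (r n)%:C * (z - 1) - z = (- t n)%:C * (z - 1).
      by rewrite /r rmorphB rmorphN rmorph1; ring.
    rewrite normcM normc_real normrN gtr0_norm//.
    apply: le_lt_trans (_ : t n * (normc (z - 1) + 1) < _).
      by rewrite ler_wpM2l ?(ltW (t0 n))// lerDl.
    rewrite -ltr_pdivlMr//.
    by near: n; apply: tcv; rewrite divr_gt0.
  have c1 : (fun n => normc (F n z)) @ \oo --> normc (f z).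
    apply/cvgrPdist_lt => d d0; move/cvgrPdist_lt : c2 => /(_ d d0).
    apply: filterS => n; rewrite sub0r normrN ger0_norm ?normc_ge0//.
    apply: le_lt_trans; rewrite ler_norml lerNl opprB le_normcB/= normcB le_normcB//.
  have cg : g n p @[n --> \oo] --> (2 * normc (f z) ^+ 2 + 2 * normc (f z) ^+ 2 - 0 ^+ 2)%:E.
    apply: cvg_EFin; first by apply: nearW.
    apply: cvgB; last by rewrite !expr2; exact: cvgM.
    by apply: cvgD; [rewrite !expr2; apply: cvgM; [exact: cvg_cst|exact: cvgM]|exact: cvg_cst].
  rewrite is_cvg_limn_einfE; last by apply/cvg_ex; eexists; exact: cg.
  rewrite (cvg_lim _ cg)// /sqmod -EFinM; congr (_%:E); rewrite -/z; ring.
have := fatou (dA R) (@measurable_Delta2 R) mg g0.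
have EI : (\int[dA R]_(p in Delta2 R) limn_einf (g ^~ p) = 4%:E * sqnorm f)%E.
  rewrite -ge0_integralZl_EFin//; try exact: measurable_Delta2; try exact: sq0; try exact: mf.
  by apply: eq_integral => p /set_mem /gl ->.
rewrite EI EA => h1; have := le_trans h1 (limn_einf_le Ig).
by rewrite -EFinM lee_fin; lra.
Unshelve. all: by end_near.
Qed.

(** * Square integrability of powers and density of polynomials *)

Lemma powR_le0_homo (R : realType) (c x y : R) : c <= 0 -> 0 < x -> x <= y -> y `^ c <= x `^ c.
Proof.
move=> c0 x0 xy; have y0 : 0 < y by exact: lt_le_trans xy.
rewrite -[c]opprK !(powRN _ (- c)) lef_pV2 ?posrE ?powR_gt0//.
by apply: ge0_ler_powR; rewrite ?oppr_ge0// nnegrE ltW.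
Qed.

Definition box2 {R : realType} (k : nat) : set (plane R) :=
  `[- (2 * (1 / 2) ^+ k), 2 * (1 / 2) ^+ k]%classic `*` `[- (2 * (1 / 2) ^+ k), 2 * (1 / 2) ^+ k]%classic.

Lemma measurable_box2 (R : realType) k : measurable (@box2 R k).
Proof. by apply: measurableX; exact: measurable_itv. Qed.

Lemma dA_box2 (R : realType) k : dA R (@box2 R k) = (16 * (1 / 4) ^+ k)%:E.
Proof.
have h0 : 0 < (1 / 2 : R) ^+ k by rewrite exprn_gt0// divr_gt0.
pose I : set (measurableTypeR R) := `[- (2 * (1 / 2) ^+ k), 2 * (1 / 2) ^+ k]%classic.
transitivity (@lebesgue_measure R I * @lebesgue_measure R I)%E.
  by apply: product_measure1E; exact: measurable_itv.
rewrite /I !lebesgue_measure_itv /= lte_fin ifT; last by lra.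
rewrite -EFinD -EFinM; congr (_%:E).
have -> : (1 / 4 : R) = (1 / 2) * (1 / 2) by field.
by rewrite [in RHS]exprMn; ring.
Qed.

Lemma Delta_normc_lt2 (R : realType) (z : R[i]) : Delta R z -> normc z < 2.
Proof.
move=> /Delta_normc h; rewrite -[z](subrK 1).
by rewrite (le_lt_trans (le_normcD _ _))// normc1; lra.
Qed.

Lemma Delta_neq0 (R : realType) (z : R[i]) : Delta R z -> z != 0.
Proof. by move=> /Delta_Re; apply: contraTneq => ->; rewrite ltxx. Qed.

Lemma cdiff_cpow_Delta (R : realType) (l z : R[i]) : Delta R z -> cdiff (fun z => cpow z l) z.
Proof. by move=> /Delta_Re; exact: cdiff_cpow. Qed.

Lemma Delta_continuous_cpow (R : realType) (l : R[i]) : Delta_continuous (fun z => cpow z l).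
Proof. by move=> z hz; apply: cdiff_ccontinuous; exact: cdiff_cpow_Delta. Qed.

Lemma normc_cpow_real (R : realType) (z : R[i]) (c : R) : z != 0 ->
  normc (cpow z c%:C) = normc z `^ c.
Proof. by move=> z0; rewrite normc_cpow//= mul0r oppr0 expR0 mulr1. Qed.

(** Take the least k with 2^-k <= x: minimality gives the upper bound, except for k = 0 where it is
    x < 2. *)
Lemma dyadic_scale (R : realType) (x : R) : 0 < x -> x < 2 ->
  exists k : nat, (1 / 2) ^+ k <= x <= 2 * (1 / 2) ^+ k.
Proof.
move=> x0 x2.
have ex : exists k : nat, (1 / 2) ^+ k <= x by apply: expr_small => //; lra.
exists (ex_minn ex); case: ex_minnP => -[|k] -> hk /=.
  by rewrite expr0 mulr1 ltW.
have -> : 2 * (1 / 2) ^+ k.+1 = (1 / 2) ^+ k :> R by rewrite exprS; field.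
rewrite leNgt.
by apply/negP => h; have := hk k (ltW h); rewrite ltnn.
Qed.

(* |z|^(2 c) is at most the sum over k of (2^-k)^(2 c) times the indicator of the
   square of half-side 2^(1-k), whose terms have integral O(4^-(k (1 + c))). *)
Lemma sqnorm_cpow_neg (R : realType) (c : R) : -1 < c -> c <= 0 ->
  (sqnorm (fun z => cpow z c%:C) < +oo)%E.
Proof.
move=> c1 c0.
(* beta = 2^-c is below 2 because c > -1; this makes the ratio q = beta^2 / 4 of the geometric
   series less than 1. *)
pose beta : R := (1 / 2) `^ c.
have b0 : 0 <= beta := powR_ge0 _ _.
have b2 : beta < 2.
  have -> : 2 = (1 / 2 : R) `^ (- 1) by rewrite powR_inv1 ?divr_ge0// invf_div divr1.
  rewrite /beta /powR gt_eqF ?divr_gt0// ltr_expR ltr_nM2r//.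
  by rewrite ln_lt0//; lra.
pose q := beta ^+ 2 * (1 / 4).
have q0 : 0 <= q by rewrite mulr_ge0 ?sqr_ge0// divr_ge0.
have q1 : q < 1.
  have : beta ^+ 2 < 2 ^+ 2 by rewrite ltrXn2r// nnegrE.
  by rewrite /q; lra.
pose h k (p : plane R) : \bar R := (((beta ^+ 2) ^+ k)%:E * (\1_(box2 k) p)%:E)%E.
have h0 k p : (0 <= h k p)%E by rewrite mule_ge0// lee_fin ?exprn_ge0 ?sqr_ge0.
have mh k : measurable_fun (Delta2 R) (h k).
  apply: measurable_funeM; apply/measurable_EFinP; apply: measurable_indic.
  exact: measurable_box2.
have Ih k : (\int[dA R]_(p in Delta2 R) h k p <= (16 * q ^+ k)%:E)%E.
  rewrite /h ge0_integralZl_EFin//; last 3 first.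
  - exact: measurable_Delta2.
  - apply/measurable_EFinP; apply: measurable_indic; exact: measurable_box2.
  - by rewrite exprn_ge0 ?sqr_ge0.
  rewrite integral_indic//; [|exact: measurable_Delta2|exact: measurable_box2].
  apply: (@le_trans _ _ (((beta ^+ 2) ^+ k)%:E * dA R (box2 k))%E).
    apply: lee_wpmul2l; first by rewrite lee_fin exprn_ge0 ?sqr_ge0.
    apply: le_measure; rewrite ?inE; [|exact: measurable_box2|exact: subIsetl].
    by apply: measurableI; [exact: measurable_box2|exact: measurable_Delta2].
  by rewrite dA_box2 -EFinM lee_fin /q [(beta ^+ 2 * _) ^+ k]exprMn mulrCA.
have le1 : (sqnorm (fun z => cpow z c%:C) <= \int[dA R]_(p in Delta2 R) \sum_(k <oo) h k p)%E.
  apply: ge0_le_integral.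
  - exact: measurable_Delta2.
  - by move=> p _; rewrite lee_fin sqr_ge0.
  - by apply: measurable_sqmod_Delta2; exact: Delta_continuous_cpow.
  - by apply: ge0_emeasurable_sum => // k p _ _.
  move=> p hp; have z0 := Delta_neq0 hp.
  rewrite /sqmod normc_cpow_real//.
  have [|k /andP[k1 k2]] := dyadic_scale _ (Delta_normc_lt2 hp); first by rewrite normc_gt0.
  (* Only the term of index k, the last of the first k + 1, is kept, k being the dyadic scale of
     |z|. *)
  apply: le_trans (nneseries_lim_ge k.+1 _) => //.
  rewrite big_mkord big_ord_recr /= -[leLHS]add0e; apply: leeD.
    by apply: sume_ge0 => i _.
  have hb : box2 k p.
    by split => /=; rewrite in_itv /= -ler_norml;
     [rewrite (le_trans (normr_Re_le (toC p)))|rewrite (le_trans (normr_Im_le (toC p)))].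
  rewrite /h indicE mem_set// mule1 lee_fin -exprM mulnC exprM.
  apply: lerXn2r; rewrite ?nnegrE ?powR_ge0 ?exprn_ge0//.
  have h2 : 0 < (1 / 2 : R) by rewrite divr_gt0.
  apply: le_trans (powR_le0_homo c0 _ k1) _; first by rewrite exprn_gt0.
  by rewrite -powR_mulrn ?(ltW h2)// powRAC -/beta powR_mulrn.
apply: le_lt_trans le1 _; rewrite integral_nneseries//; last exact: measurable_Delta2.
apply: (@le_lt_trans _ _ (16 / (1 - q))%:E); last exact: ltry.
apply: lime_le; first by apply: is_cvg_nneseries => n _ _; apply: integral_ge0.
apply: nearW => n.
apply: (@le_trans _ _ (\sum_(0 <= i < n) (16 * q ^+ i)%:E)%E); first by apply: lee_sum => i _; exact: Ih.
rewrite sumEFin lee_fin.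
have := @geometric_seriesE R 16 q; rewrite lt_eqF// => /(_ isT)/(congr1 (fun u => u n)).
rewrite /series /geometric /= => ->.
rewrite ler_wpM2r ?invr_ge0 ?subr_ge0 ?(ltW q1)//.
by rewrite ler_piMr// gerBl exprn_ge0.
Qed.

Lemma sqnormZ (R : realType) (k : R[i]) (f : R[i] -> R[i]) : Delta_continuous f ->
  sqnorm (fun z => k * f z) = ((normc k ^+ 2)%:E * sqnorm f)%E.
Proof.
move=> cf; rewrite /sqnorm -ge0_integralZl_EFin//; last 4 first.
- exact: measurable_Delta2.
- by move=> p _; rewrite lee_fin sqr_ge0.
- exact: measurable_sqmod_Delta2.
- exact: sqr_ge0.
by apply: eq_integral => p _; rewrite /sqmod normcM exprMn EFinM.
Qed.

Lemma Delta_continuous_cst (R : realType) (k : R[i]) : Delta_continuous (fun=> k).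
Proof. by move=> z _ e e0; exists 1 => // t _; rewrite subrr normc0. Qed.

(** 16 is the area of the square [-2, 2] x [-2, 2], which contains Delta. *)
Lemma sqnorm_cst_le (R : realType) (k : R[i]) : (sqnorm (fun=> k) <= (16 * normc k ^+ 2)%:E)%E.
Proof.
rewrite /sqnorm integral_cst; last exact: measurable_Delta2.
rewrite (_ : (16 * normc k ^+ 2)%:E = ((normc k ^+ 2)%:E * 16%:E)%E); last by rewrite -EFinM mulrC.
apply: lee_wpmul2l; first by rewrite lee_fin sqr_ge0.
have -> : 16%:E = dA R (@box2 R 0) by rewrite dA_box2 expr0 mulr1.
apply: le_measure; rewrite ?inE; [exact: measurable_Delta2|exact: measurable_box2|].
move=> p hp; have h2 := Delta_normc_lt2 hp.
by split => /=; rewrite in_itv /= expr0 mulr1 -ler_norml;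
     [rewrite (le_trans (normr_Re_le (toC p)))// ltW|rewrite (le_trans (normr_Im_le (toC p)))// ltW].
Qed.

Lemma sqnorm_unif_le (R : realType) (f g : R[i] -> R[i]) (e : R) : Delta_continuous f -> Delta_continuous g -> 0 <= e ->
  (forall z, Delta R z -> normc (f z - g z) <= e) ->
  (sqnorm (fun z => (f z - g z)%R) <= (16 * e ^+ 2)%:E)%E.
Proof.
move=> cf cg e0 h; have := sqnorm_cst_le e%:C; rewrite normc_real ger0_norm//; apply: le_trans.
apply: sqnorm_le; [exact: Delta_continuousB|exact: Delta_continuous_cst|move=> z /h].
by rewrite normc_real ger0_norm.
Qed.

(** Im l contributes only a factor bounded by K, arguments being bounded by pi. What is left is the
    real power, treated by [sqnorm_cpow_neg] when Re l <= 0 and bounded on Delta otherwise. *)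
Lemma sqnorm_cpow_fin (R : realType) (l : R[i]) : -1 < complex.Re l ->
  (sqnorm (fun z => cpow z l) < +oo)%E.
Proof.
move=> l1; pose K := expR (`|complex.Im l| * pi).
have K0 : 0 <= K := expR_ge0 _.
have [l0|l0] := leP (complex.Re l) 0.
  have h : (sqnorm (fun z => (K%:C * cpow z (complex.Re l)%:C)%R) < +oo)%E.
    rewrite sqnormZ; last exact: Delta_continuous_cpow.
    by apply: lte_mul_pinfty; rewrite ?lee_fin ?sqr_ge0//; exact: sqnorm_cpow_neg.
  apply: le_lt_trans h; apply: sqnorm_le.
  - exact: Delta_continuous_cpow.
  - move=> z hz; apply: cdiff_ccontinuous; apply: (@cdiffM R (fun=> K%:C)); first exact: cdiff_cst.
    exact: cdiff_cpow_Delta.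
  move=> z /Delta_neq0 hz; rewrite normcM normc_cpow_real// normc_real ger0_norm//.
  by rewrite mulrC normc_cpow_le.
have h : (sqnorm (fun z : R[i] => (K * 2 `^ complex.Re l)%R%:C) < +oo)%E.
  by apply: le_lt_trans (sqnorm_cst_le _) _; exact: ltry.
apply: le_lt_trans h; apply: sqnorm_le; [exact: Delta_continuous_cpow|exact: Delta_continuous_cst|].
move=> z hz; rewrite normc_real ger0_norm ?mulr_ge0 ?powR_ge0//.
rewrite (le_trans (normc_cpow_le _ (Delta_neq0 hz)))// mulrC ler_wpM2l//.
apply: ge0_ler_powR; rewrite ?nnegrE ?normc_ge0 ?(ltW l0)//.
exact: ltW (Delta_normc_lt2 hz).
Qed.

Lemma sqnorm_abs (R : realType) (f : R[i] -> R[i]) :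
  (\int[dA R]_(p in Delta2 R) `|sqmod f p|)%E = sqnorm f.
Proof. by apply: eq_integral => p _; rewrite gee0_abs// lee_fin sqr_ge0. Qed.

Lemma sqnorm_integrable (R : realType) (f : R[i] -> R[i]) : Delta_continuous f -> (sqnorm f < +oo)%E ->
  (dA R).-integrable (toC @^-1` Delta R) (sqmod f).
Proof.
by move=> cf ffin; apply/integrableP; split; [exact: measurable_sqmod_Delta2|rewrite [X in (X < _)%E]sqnorm_abs].
Qed.

Lemma integrable_sqnorm (R : realType) (f : R[i] -> R[i]) :
  (dA R).-integrable (toC @^-1` Delta R) (sqmod f) -> (sqnorm f < +oo)%E.
Proof. by move=> /integrableP[_]; rewrite [X in (X < _)%E -> _]sqnorm_abs. Qed.

Lemma Delta_continuous_horner (R : realType) (p : {poly R[i]}) : Delta_continuous (fun z => p.[z]).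
Proof.
by move=> z _; apply: cdiff_ccontinuous; exact: (@cdiff_horner R p id z (@cdiff_id R z)).
Qed.

Lemma sqnorm_triangle_lt (R : realType) (f g h : R[i] -> R[i]) (a b : R) :
  Delta_continuous f -> Delta_continuous g -> Delta_continuous h ->
  (sqnorm (fun z => (f z - g z)%R) < a%:E)%E -> (sqnorm (fun z => (g z - h z)%R) < b%:E)%E ->
  (sqnorm (fun z => (f z - h z)%R) < (2 * a + 2 * b)%:E)%E.
Proof.
move=> cf cg ch h1 h2; apply: le_lt_trans (sqnorm_triangle cf cg ch) _.
rewrite (_ : (2 * a + 2 * b)%:E = (2%:E * a%:E + 2%:E * b%:E)%E); last by rewrite -!EFinM -EFinD.
by apply: lteD; rewrite lte_pmul2l.
Qed.

Lemma Bergman_poly_approx (R : realType) (f : R[i] -> R[i]) (e : R) :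
  holomorphic_on (Delta R) f -> (sqnorm f < +oo)%E -> 0 < e ->
  exists p : {poly R[i]}, (sqnorm (fun z => (f z - p.[z])%R) < e%:E)%E.
Proof.
move=> hf ffin e0.
have df z : Delta R z -> cdiff f z by exact: hf.
have cf : Delta_continuous f by move=> z hz; apply: cdiff_ccontinuous; exact: df.
have e4 : 0 < e / 4 by rewrite divr_gt0.
have [r [r0 r1 hr]] := dil_approx cf ffin e4.
pose fr z := f (1 + r%:C * (z - 1)).
have cfr : Delta_continuous fr by apply: Delta_continuous_dil => //; exact: ltW.
(* As eta <= 1, 16 eta^2 <= 16 eta <= e / 8, within the budget e / 4 left by the dilation. *)
pose eta := Num.min 1 (e / 128).
have eta0 : 0 < eta by rewrite lt_min ltr01 divr_gt0.
have eta2 : 16 * eta ^+ 2 <= e / 8.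
  have h1 : eta <= 1 by rewrite ge_min lexx.
  have h2 : eta <= e / 128 by rewrite ge_min lexx orbT.
  have : eta ^+ 2 <= eta by rewrite expr2 ler_piMr// ltW.
  by lra.
have rV : 1 < r^-1 by rewrite invf_gt1.
have [||||p Hp] := @holomorphic_poly_approx R fr 1 1 r^-1 eta => //.
  move=> w hw; apply: (@cdiff_comp R f (fun z => 1 + r%:C * (z - 1))).
    apply: (@cdiffD R (fun=> 1)); first exact: cdiff_cst.
    by apply: (@cdiffM R (fun=> r%:C)); [exact: cdiff_cst|exact: cdiff_subc].
  apply: df; apply/Delta_normc; rewrite addrAC subrr add0r normcM normc_real gtr0_norm//.
  by rewrite mulrC -ltr_pdivlMr// mul1r.
exists p; have cp : Delta_continuous (fun z => p.[z]) by exact: Delta_continuous_horner.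
have -> : e = 2 * (e / 4) + 2 * (e / 4) by field.
apply: (@sqnorm_triangle_lt _ f fr) => //.
  by rewrite (_ : sqnorm _ = sqnorm (fun z => (fr z - f z)%R))//;
    apply: eq_sqnorm => z _; exact: normcB.
apply: (@le_lt_trans _ _ (16 * eta ^+ 2)%:E); last by rewrite lte_fin; lra.
by apply: sqnorm_unif_le => //; [exact: ltW|move=> z /Delta_normc/ltW; exact: Hp].
Qed.

(** * The powers z^(l0 + a k) *)

(* On Delta, w = z^a satisfies |w| <= 2 and |arg w| <= a * pi / 2; with
   M = 1 / cos (a * pi / 2) this gives |w|^2 <= 2 * M * Re w, that is,
   |w - M| <= M. *)
Lemma cpow_Delta (R : realType) (a : R) (z : R[i]) : 0 < a -> a < 1 -> Delta R z ->
  [/\ clog (cpow z a%:C) = a%:C * clog z, 0 < complex.Re (cpow z a%:C),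
      normc (cpow z a%:C) = normc z `^ a,  normc (cpow z a%:C) <= 2 &
      normc (cpow z a%:C - ((cos (a * (pi / 2)))^-1)%:C) <= (cos (a * (pi / 2)))^-1].
Proof.
move=> a0 a1 hz; have z0 := Delta_neq0 hz; have p0 := pi_gt0 R.
have hc := normr_carg_lt_pihalf (Delta_Re hz).
have Im_ : complex.Im (a%:C * clog z) = a * carg z.
  by rewrite Im_mul /= mul0r addr0.
have hac : `|a * carg z| <= a * (pi / 2) by rewrite normrM gtr0_norm// ler_wpM2l// ltW.
have hap : a * (pi / 2) < pi / 2 by rewrite gtr_pMl// divr_gt0.
have cp : 0 < cos (a * (pi / 2)).
  by apply: cos_gt0_pihalf; rewrite hap andbT (lt_le_trans (_ : _ < 0))// ?oppr_lt0 ?divr_gt0//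
     mulr_ge0 ?ltW// divr_gt0.
have ccl : cos (a * (pi / 2)) <= cos (a * carg z).
  rewrite -[cos (a * carg z)]cos_norm leNgt ltr_cos ?in_itv /= -?leNgt//.
    by apply/andP; split; [rewrite mulr_ge0 ?ltW// divr_gt0|lra].
  by rewrite normr_ge0 /=; lra.
have nE : normc (cpow z a%:C) = normc z `^ a by exact: normc_cpow_real.
have n2 : normc (cpow z a%:C) <= 2.
  rewrite nE; apply: le_trans (_ : 2 `^ a <= _).
    by apply: ge0_ler_powR; rewrite ?nnegrE ?normc_ge0 ?ltW// Delta_normc_lt2.
  by apply: ler1_powR; [rewrite ler1n|exact: ltW].
have rE : complex.Re (cpow z a%:C) = normc (cpow z a%:C) * cos (a * carg z).
  by rewrite normc_cexp -Im_.
have npos : 0 < normc (cpow z a%:C) by rewrite normc_gt0 cexp_neq0.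
split=> //.
- by apply: clogK; rewrite Im_ (le_lt_trans hac)// (lt_trans hap)//; lra.
- by rewrite rE mulr_gt0// (lt_le_trans cp).
set M := (cos _)^-1; have M0 : 0 < M by rewrite invr_gt0.
have h1 : 1 <= M * cos (a * carg z).
  by rewrite /M mulrC ler_pdivlMr// mul1r.
move: rE n2 npos; set w := cpow z a%:C; move: (w) => {}w rE n2 npos.
suff h : normc (w - M%:C) ^+ 2 <= M ^+ 2.
  by move: h; rewrite ler_pXn2r// nnegrE ?normc_ge0// ltW.
have ReE : complex.Re (w - M%:C) = complex.Re w - M by rewrite Re_add Re_opp.
have ImE : complex.Im (w - M%:C) = complex.Im w by rewrite Im_add Im_opp /= subr0.
have En := sqr_normcE w.
rewrite sqr_normcE ReE ImE.
have h2 : normc w <= 2 * (M * cos (a * carg z)) by lra.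
have h3 : normc w * normc w <= normc w * (2 * (M * cos (a * carg z))) by rewrite ler_wpM2l// ltW.
have -> : (complex.Re w - M) ^+ 2 + complex.Im w ^+ 2 =
  complex.Re w ^+ 2 + complex.Im w ^+ 2 - 2 * M * complex.Re w + M ^+ 2 by ring.
by rewrite -En rE expr2; lra.
Qed.

(** The function G of the overview: G(w) = p(w^(1/a)) w^(-l0/a). *)
Definition powpoly {R : realType} (a : R) (l0 : R[i]) (p : {poly R[i]}) (w : R[i]) : R[i] :=
  p.[cpow w (a^-1)%:C] * cpow w (- l0 / a%:C).

Lemma cdiff_powpoly (R : realType) (a : R) (l0 : R[i]) (p : {poly R[i]}) (w : R[i]) :
  0 < complex.Re w -> cdiff (powpoly a l0 p) w.
Proof.
move=> w0; apply: (@cdiffM R (fun w => p.[cpow w (a^-1)%:C]) (fun w => cpow w (- l0 / a%:C))).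
  by apply: (@cdiff_horner R p (fun w => cpow w (a^-1)%:C)); exact: cdiff_cpow.
exact: cdiff_cpow.
Qed.

(** On Delta log (z^a) = a log z, so w^(1/a) gives back z and w^(-l0/a) cancels z^l0. *)
Lemma powpoly_pow (R : realType) (a : R) (l0 : R[i]) (p : {poly R[i]}) (z : R[i]) :
  0 < a -> a < 1 -> Delta R z -> cpow z l0 * powpoly a l0 p (cpow z a%:C) = p.[z].
Proof.
move=> a0 a1 hz; have [E _ _ _ _] := cpow_Delta a0 a1 hz.
have an0 : a%:C != 0 :> R[i] by rewrite -normc_gt0 normc_real normr_gt0 gt_eqF.
have Ea : (a^-1)%:C = (a%:C)^-1 :> R[i] by rewrite fmorphV.
rewrite /powpoly; set w := cpow z a%:C in E *.
have -> : cpow w (a^-1)%:C = z.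
  by rewrite /cpow E Ea mulrA mulVf// mul1r cexp_clog// Delta_neq0.
rewrite mulrCA /cpow E -cexpD.
have -> : l0 * clog z + - l0 / a%:C * (a%:C * clog z) = 0 by field.
by rewrite cexp0 mulr1.
Qed.

(* The shift by e moves the argument of [powpoly] away from its singularity at
   0, so that [powpoly] is holomorphic around the whole closed disc of
   [cpow_Delta]. *)
Definition powshift {R : realType} (a : R) (l0 : R[i]) (p : {poly R[i]}) (e : R) (z : R[i]) : R[i] :=
  cpow z l0 * powpoly a l0 p (cpow z a%:C + e%:C).

Lemma cdiff_powshift (R : realType) (a : R) (l0 : R[i]) (p : {poly R[i]}) (e : R) (z : R[i]) :
  0 < a -> a < 1 -> 0 <= e -> Delta R z -> cdiff (powshift a l0 p e) z.
Proof.
move=> a0 a1 e0 hz; have [_ r0 _ _ _] := cpow_Delta a0 a1 hz.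
apply: (@cdiffM R (fun z => cpow z l0) (fun z => powpoly a l0 p (cpow z a%:C + e%:C))).
  exact: cdiff_cpow_Delta.
apply: (@cdiff_comp R (powpoly a l0 p) (fun z => cpow z a%:C + e%:C)).
  by apply: (@cdiffD R (fun z => cpow z a%:C) (fun=> e%:C)); [exact: cdiff_cpow_Delta|exact: cdiff_cst].
by apply: cdiff_powpoly; rewrite Re_add /= ltr_wpDr.
Qed.

Lemma horner_bounded (R : realType) (p : {poly R[i]}) (rho : R) :
  exists2 C : R, 0 <= C & forall z, normc z <= rho -> normc p.[z] <= C.
Proof.
have [rho0|rho0] := leP 0 rho; last first.
  by exists 0 => // z hz; have := normc_ge0 z; lra.
exists (\sum_(i < size p) normc p`_i * rho ^+ i).
  by apply: sumr_ge0 => i _; rewrite mulr_ge0 ?normc_ge0 ?exprn_ge0.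
move=> z hz; rewrite horner_coef; apply: le_trans (normc_sum _ _) _.
apply: ler_sum => i _; rewrite normcM normcX ler_wpM2l ?normc_ge0//.
by rewrite lerXn2r ?nnegrE ?normc_ge0.
Qed.

(** The majorant for dominated convergence. With w = z^a and u = w + e, the danger is |z|^c0
    |u|^(-c0/a). If c0 >= 0, then |u| >= |w| = |z|^a because Re w > 0, and the product is at most 1.
    If c0 < 0, the exponent of |u| is positive and |u| <= 3. *)
Lemma powshift_bound (R : realType) (a c0 b : R) (p : {poly R[i]}) :
  0 < a -> a < 1 ->
  exists2 C : R, 0 <= C & forall z e, Delta R z -> 0 < e -> e <= 1 ->
    normc (powshift a (c0 +i* b) p e z) <= C * (1 + normc z `^ c0).
Proof.
move=> a0 a1; set l0 := c0 +i* b.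
(* |u| <= |w| + e <= 2 + 1, so p is evaluated in the disc of radius 3^(1/a). *)
have [Cp Cp0 HCp] := horner_bounded p (3 `^ a^-1).
pose K := expR (`|complex.Im (- l0 / a%:C)| * pi).
pose K' := expR (`|b| * pi).
have K0 : 0 <= K := expR_ge0 _.
have K'0 : 0 <= K' := expR_ge0 _.
pose T := 1 + 3 `^ (- c0 / a).
have T0 : 0 <= T by rewrite addr_ge0// powR_ge0.
have Re2 : complex.Re (- l0 / a%:C) = - c0 / a.
  rewrite (_ : (a%:C)^-1 = (a^-1)%:C :> R[i]); last by rewrite fmorphV.
  by rewrite Re_mul /= mulr0 subr0.
exists (Cp * K * K' * T); first by rewrite !mulr_ge0.
move=> z e hz e0 e1; have [_ r0 nE n2 _] := cpow_Delta a0 a1 hz.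
have z0 := Delta_neq0 hz; have nz0 : 0 < normc z by rewrite normc_gt0.
set w := cpow z a%:C in r0 nE n2; set u := w + e%:C.
have Ru : complex.Re u = complex.Re w + e by rewrite Re_add.
have Iu : complex.Im u = complex.Im w by rewrite Im_add addr0.
have u0 : u != 0.
  by apply: contraTneq (addr_gt0 r0 e0) => h; rewrite -Ru h ltxx.
have nu0 : 0 < normc u by rewrite normc_gt0.
have nu3 : normc u <= 3.
  by rewrite (le_trans (le_normcD _ _))// normc_real gtr0_norm//; lra.
have nwu : normc w <= normc u.
  rewrite -(@ler_pXn2r _ 2)// ?nnegrE ?normc_ge0// !sqr_normcE Ru Iu lerD2r.
  by rewrite lerXn2r// ?nnegrE ?addr_ge0 ?(ltW r0) ?(ltW e0)// lerDl ltW.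
have h1 : normc p.[cpow u (a^-1)%:C] <= Cp.
  apply: HCp; rewrite normc_cpow_real//;
  apply: ge0_ler_powR; rewrite ?nnegrE ?normc_ge0 ?invr_ge0 ?(ltW a0)//.
have h2 : normc (cpow u (- l0 / a%:C)) <= normc u `^ (- c0 / a) * K.
  by rewrite -Re2; exact: normc_cpow_le.
have h3 : normc (cpow z l0) <= normc z `^ c0 * K'.
  by have := normc_cpow_le l0 z0.
have h4 : normc z `^ c0 * normc u `^ (- c0 / a) <= T * (1 + normc z `^ c0).
  have zc0 : 0 < normc z `^ c0 by rewrite powR_gt0.
  have t0 : 0 <= 3 `^ (- c0 / a) :> R by exact: powR_ge0.
  have [c00|c00] := leP 0 c0.
    have h : normc u `^ (- c0 / a) <= (normc z `^ c0)^-1.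
      have -> : (normc z `^ c0)^-1 = normc w `^ (- c0 / a).
        by rewrite nE -powRrM -powRN; congr (_ `^ _); field; exact: lt0r_neq0.
      apply: powR_le0_homo => //.
        by rewrite mulNr oppr_le0 divr_ge0// ltW.
      by rewrite nE powR_gt0.
    have : normc z `^ c0 * normc u `^ (- c0 / a) <= 1.
      by rewrite mulrC -ler_pdivlMr// mul1r.
    rewrite /T; set x := normc z `^ c0 in zc0 *; set y := 3 `^ _ in t0 *.
    by have := mulr_ge0 t0 (ltW zc0); lra.
  have h : normc u `^ (- c0 / a) <= 3 `^ (- c0 / a).
    apply: ge0_ler_powR; rewrite ?nnegrE ?normc_ge0//.
    by rewrite divr_ge0// ?ltW// oppr_gt0.
  have : normc z `^ c0 * normc u `^ (- c0 / a) <= normc z `^ c0 * 3 `^ (- c0 / a).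
    by rewrite ler_wpM2l// ltW.
  by rewrite /T; lra.
rewrite /powshift /powpoly -/w -/u !normcM.
apply: le_trans (_ : (normc z `^ c0 * K') * (Cp * (normc u `^ (- c0 / a) * K)) <= _).
  by rewrite ler_pM ?mulr_ge0 ?normc_ge0// ler_pM ?normc_ge0.
have -> : (normc z `^ c0 * K') * (Cp * (normc u `^ (- c0 / a) * K)) =
   (Cp * K * K') * (normc z `^ c0 * normc u `^ (- c0 / a)) by ring.
by rewrite -[leRHS]mulrA ler_wpM2l// !mulr_ge0.
Qed.

Lemma Delta_continuous_powshift (R : realType) (a : R) (l0 : R[i]) (p : {poly R[i]}) (e : R) :
  0 < a -> a < 1 -> 0 <= e -> Delta_continuous (powshift a l0 p e).
Proof. by move=> a0 a1 e0 z hz; apply: cdiff_ccontinuous; exact: cdiff_powshift. Qed.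

Lemma powshift_cvg (R : realType) (a : R) (l0 : R[i]) (p : {poly R[i]}) (z : R[i]) :
  0 < a -> a < 1 -> Delta R z -> forall d : R, 0 < d ->
  exists2 e0 : R, 0 < e0 & forall e, 0 < e -> e < e0 -> normc (powshift a l0 p e z - p.[z]) < d.
Proof.
move=> a0 a1 hz d d0; have [_ r0 _ _ _] := cpow_Delta a0 a1 hz.
have : ccontinuous (fun w => cpow z l0 * powpoly a l0 p w) (cpow z a%:C).
  apply: cdiff_ccontinuous; apply: (@cdiffM R (fun=> cpow z l0) (powpoly a l0 p)); first exact: cdiff_cst.
  exact: cdiff_powpoly.
move=> /(_ _ d0)[e1 e10 H]; exists e1 => // e e0 ee.
have := H (cpow z a%:C + e%:C); rewrite (powpoly_pow l0 p a0 a1 hz).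
by apply; rewrite addrAC subrr add0r normc_real gtr0_norm.
Qed.

Lemma powshift_approx (R : realType) (a c0 b : R) (p : {poly R[i]}) (d : R) :
  0 < a -> a < 1 -> -1 < c0 -> 0 < d ->
  exists2 e : R, 0 < e & (sqnorm (fun z => (powshift a (c0 +i* b) p e z - p.[z])%R) < d%:E)%E.
Proof.
move=> a0 a1 c01 d0; set l0 := c0 +i* b.
have [C C0 HC] := powshift_bound c0 b p a0 a1.
have [C' C'0 HC'] := horner_bounded p 2.
pose eps n : R := n.+1%:R^-1.
have eps0 n : 0 < eps n by rewrite invr_gt0 ltr0n.
have eps1 n : eps n <= 1 by rewrite invf_le1 ?ltr0n// ler1n.
pose F n z := powshift a l0 p (eps n) z - p.[z].
have cF n : Delta_continuous (F n).
  by apply: Delta_continuousB; [apply: Delta_continuous_powshift => //; exact: ltW|exact: Delta_continuous_horner].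
(* |F n z| <= u + v with u = C + C' and v = C |z|^c0, and (u + v)^2 <= (2 u)^2 + (2 v)^2. The
   majorant is then a sum of [sqmod] of two functions already known to be square integrable; c0 > -1
   is used for the second. *)
pose K1 : R[i] := (2 * (C + C'))%:C; pose K2 : R[i] := (2 * C)%:C.
pose h2 z := K2 * cpow z c0%:C.
have cK1 : Delta_continuous (fun=> K1) := @Delta_continuous_cst R K1.
have ch2 : Delta_continuous h2.
  move=> z hz; apply: cdiff_ccontinuous; apply: (@cdiffM R (fun=> K2)); first exact: cdiff_cst.
  exact: cdiff_cpow_Delta.
pose g (q : plane R) : \bar R := (sqmod (fun=> K1) q + sqmod h2 q)%E.
have ig : (dA R).-integrable (Delta2 R) g.
  apply: integrableD; first exact: measurable_Delta2.
    by apply: sqnorm_integrable => //; apply: le_lt_trans (sqnorm_cst_le _) _; exact: ltry.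
  apply: sqnorm_integrable => //; rewrite sqnormZ; last exact: Delta_continuous_cpow.
  by apply: lte_mul_pinfty; rewrite ?lee_fin ?sqr_ge0//; apply: sqnorm_cpow_fin.
have Fg n q : Delta2 R q -> (`|sqmod (F n) q| <= g q)%E.
  move=> hq; rewrite gee0_abs ?lee_fin ?sqr_ge0//.
  set z := toC q; have z0 := Delta_neq0 hq.
  have x0 : 0 <= normc z `^ c0 by exact: powR_ge0.
  have -> : normc (h2 z) = 2 * C * normc z `^ c0.
    by rewrite normcM normc_cpow_real// normc_real ger0_norm// mulr_ge0.
  have -> : normc K1 = 2 * (C + C') by rewrite normc_real ger0_norm// mulr_ge0// addr_ge0.
  have hF : normc (F n z) <= (C + C') + C * normc z `^ c0.
    apply: le_trans (le_normcD _ _) _; rewrite normcN.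
    have := HC z (eps n) hq (eps0 n) (eps1 n).
    have := HC' z (ltW (Delta_normc_lt2 hq)); rewrite -/l0; lra.
  move: (normc (F n z)) (normc_ge0 (F n z)) hF => y y0 hF.
  have D0 : 0 <= C + C' by rewrite addr_ge0.
  have E0 : 0 <= C * normc z `^ c0 by rewrite mulr_ge0.
  apply: le_trans (_ : ((C + C') + C * normc z `^ c0) ^+ 2 <= _).
    by rewrite lerXn2r ?nnegrE ?addr_ge0.
  rewrite -[2 * C * _]mulrA; move: (C + C') (C * normc z `^ c0) D0 E0 => u v u0 v0.
  by have := sqr_ge0 (u - v); rewrite sqrrB sqrrD !exprMn; have := sqr_ge0 u; have := sqr_ge0 v; lra.
have Fc q : Delta2 R q -> sqmod (F n) q @[n --> \oo] --> (0%R)%:E.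
  move=> hq; set z := toC q.
  have c1 : (fun n => normc (F n z)) @ \oo --> (0 : R).
    apply/cvgrPdist_lt => k k0; have [e1 e10 He] := powshift_cvg l0 p a0 a1 hq k0.
    have [m hm] := ltr_natSinv e10.
    exists m => // n /= mn; rewrite sub0r normrN ger0_norm ?normc_ge0//; apply: He => //.
    by apply: le_lt_trans hm; rewrite lef_pV2 ?posrE ?ltr0n// ler_nat ltnS.
  apply: cvg_EFin; first exact: nearW.
  rewrite (_ : fine \o _ = (fun n => normc (F n z) * normc (F n z))).
    by rewrite -[X in _ --> X](mulr0 (0 : R)); exact: (cvgM c1 c1).
  by apply/funext => n; rewrite -expr2.
have mF n : measurable_fun (Delta2 R) (sqmod (F n) : plane R -> \bar R) := measurable_sqmod_Delta2 (cF n).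
have [_ _] := @dominated_convergence _ (plane R) R (dA R) (Delta2 R) (@measurable_Delta2 R) (fun n => sqmod (F n))
  (cst 0%E) g
  mF (measurable_cst _) (aeW _ Fc) ig (aeW _ (fun q n => Fg n q)).
rewrite integral0 => Ic.
have [N _ HN] := Ic _ (@nbhs_open_ereal_lt R 0 (fun=> d) d0).
by exists (eps N) => //; exact: (HN N (leqnn N)).
Qed.

(** G(w + e) is holomorphic for Re w > -e, hence on the disc of centre M and radius M + e, which
    exceeds the disc of radius M containing z^a. A uniform error eta there becomes a squared norm of
    at most eta^2 A, with A that of z^l0. *)
Lemma powshift_poly (R : realType) (a c0 b e : R) (p : {poly R[i]}) (d : R) :
  0 < a -> a < 1 -> -1 < c0 -> 0 < e -> 0 < d ->
  exists P : {poly R[i]}, (sqnorm (fun z => (powshift a (c0 +i* b) p e z -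
     cpow z (c0 +i* b) * P.[cpow z a%:C])%R) < d%:E)%E.
Proof.
move=> a0 a1 c01 e0 d0; set l0 := c0 +i* b.
pose M := (cos (a * (pi / 2)))^-1.
have M0 : 0 < M.
  have p0 := pi_gt0 R; have hap : a * (pi / 2) < pi / 2 by rewrite gtr_pMl// divr_gt0.
  rewrite invr_gt0 cos_gt0_pihalf// hap andbT.
  by apply: (@lt_trans _ _ 0); rewrite ?oppr_lt0 ?mulr_gt0 ?divr_gt0.
have := @sqnorm_cpow_fin R l0 c01; have := sqnorm_ge0 (fun z => cpow z l0).
case EA : (sqnorm (fun z => cpow z l0)) => [A| |] // A0 _.
rewrite lee_fin in A0.
pose eta := Num.min 1 (d / (2 * (A + 1))).
have A1 : 0 < 2 * (A + 1) by lra.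
have eta0 : 0 < eta by rewrite lt_min ltr01 divr_gt0.
have eta2 : eta ^+ 2 * A < d.
  have h1 : eta <= 1 by rewrite ge_min lexx.
  have h2 : eta * (2 * (A + 1)) <= d by rewrite -ler_pdivlMr// ge_min lexx orbT.
  have h3 : eta ^+ 2 <= eta by rewrite expr2 ler_piMr// ltW.
  have h4 : eta ^+ 2 * A <= eta * A by rewrite ler_wpM2r.
  by have := mulr_ge0 (ltW eta0) A0; lra.
have [||||P HP] := @holomorphic_poly_approx R (fun w => powpoly a l0 p (w + e%:C)) M%:C M (M + e) eta => //.
- by rewrite ltrDl.
- move=> w hw; apply: (@cdiff_comp R (powpoly a l0 p) (fun w => w + e%:C)).
    by apply: (@cdiffD R id (fun=> e%:C)); [exact: cdiff_id|exact: cdiff_cst].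
  apply: cdiff_powpoly; have := le_lt_trans (normr_Re_le _) hw.
  rewrite !Re_add Re_opp /= ltr_norml => /andP[]; lra.
exists P.
have cz1 : Delta_continuous (fun z => cpow z l0 * P.[cpow z a%:C]).
  move=> z hz; apply: cdiff_ccontinuous; apply: (@cdiffM R (fun z => cpow z l0) (fun z => P.[cpow z a%:C])).
    exact: cdiff_cpow_Delta.
  by apply: (@cdiff_horner R P (fun z => cpow z a%:C)); exact: cdiff_cpow_Delta.
apply: (@le_lt_trans _ _ (sqnorm (fun z => (eta%:C * cpow z l0)%R))).
  apply: sqnorm_le.
  - by apply: Delta_continuousB => //; apply: Delta_continuous_powshift => //; exact: ltW.
  - move=> z hz; apply: cdiff_ccontinuous; apply: (@cdiffM R (fun=> eta%:C)); first exact: cdiff_cst.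
    exact: cdiff_cpow_Delta.
  move=> z hz; have [_ _ _ _ hM] := cpow_Delta a0 a1 hz.
  rewrite /powshift -mulrBr normcM [leRHS]normcM mulrC normc_real ger0_norm ?(ltW eta0)//.
  by rewrite ler_wpM2r ?normc_ge0//; exact: HP.
rewrite sqnormZ; last exact: Delta_continuous_cpow.
by rewrite EA normc_real ger0_norm ?(ltW eta0)// -EFinM lte_fin.
Qed.

Lemma lte_sqrte (R : realType) (x : \bar R) (e : R) : 0 < e -> (0 <= x)%E ->
  (x < (e ^+ 2)%:E)%E -> (sqrte x < e%:E)%E.
Proof.
case: x => [x| |]//= e0; rewrite !(lee_fin, lte_fin) => x0 h.
rewrite -[ltRHS]ger0_norm ?(ltW e0)// -sqrtr_sqr ltr_sqrt// exprn_gt0//.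
Qed.

Theorem theorem2p1 (R : realType) (a c0 b : R)
    (ha0 : 0 < a) (ha1 : a < 1) (hc0 : -1 < c0) :
  let lambda (k : nat) : R[i] := (a * k%:R + c0) +i* b in
  let S : set (R[i] -> R[i]) :=
    range (fun (k : nat) (z : R[i]) => cpow z (lambda k)) in
  S `<=` Bergman (Delta R) /\ complete_in_Bergman (Delta R) S.
Proof.
move=> lambda S; split.
  move=> _ [k _ <-]; split; first by move=> z hz; exact: cdiff_cpow_Delta.
  apply: sqnorm_integrable; first exact: Delta_continuous_cpow.
  apply: sqnorm_cpow_fin; rewrite /lambda /= (lt_le_trans hc0)// lerDr mulr_ge0 ?(ltW ha0)//.
move=> f [hf /integrable_sqnorm ffin] e e0.
(* Three errors below d, chained by two triangle inequalities, give 2 d + 2 (2 d + 2 d) = 10 d <=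
   e^2. *)
pose d := e ^+ 2 / 16; have d0 : 0 < d by rewrite divr_gt0// exprn_gt0.
pose l0 : R[i] := c0 +i* b.
have [p Hp] := Bergman_poly_approx hf ffin d0.
have [t t0 Ht] := powshift_approx b p ha0 ha1 hc0 d0.
have [P HP] := powshift_poly b p ha0 ha1 hc0 t0 d0.
have cf : Delta_continuous f by move=> z /hf; exact: cdiff_ccontinuous.
have cp : Delta_continuous (fun z => p.[z]) := Delta_continuous_horner p.
have cs : Delta_continuous (powshift a l0 p t) by apply: Delta_continuous_powshift => //; exact: ltW.
pose g z := \sum_(i < size P) P`_i * cpow z (lambda i).
(* z^l0 (z^a)^i = z^(lambda i): the coefficients of P are those of the linear combination. *)
have gE z : g z = cpow z l0 * P.[cpow z a%:C].
  rewrite horner_coef mulr_sumr; apply: eq_bigr => i _.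
  rewrite mulrCA -cpowM_nat -cpowD; congr (_ * cpow _ _).
  rewrite /lambda /l0 (_ : (i%:R : R[i]) = (i%:R)%:C); last by rewrite rmorph_nat.
  by rewrite mulcE addcE; congr (_ +i* _); ring.
have cg : Delta_continuous g.
  move=> z hz; apply: cdiff_ccontinuous; rewrite (_ : g = fun z => cpow z l0 * P.[cpow z a%:C]);
    last exact/funext.
  apply: (@cdiffM R (fun z => cpow z l0) (fun z => P.[cpow z a%:C])); first exact: cdiff_cpow_Delta.
  by apply: (@cdiff_horner R P (fun z => cpow z a%:C)); exact: cdiff_cpow_Delta.
exists g.
  exists (size P), (fun i z => cpow z (lambda i)), (fun i => P`_i); split => //.
  by move=> i; exists (val i).
apply: lte_sqrte => //; first exact: sqnorm_ge0.
have h1 : (sqnorm (fun z => (p.[z] - powshift a l0 p t z)%R) < d%:E)%E.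
  by rewrite (_ : sqnorm _ = sqnorm (fun z => (powshift a l0 p t z - p.[z])%R))//;
    apply: eq_sqnorm => z _; exact: normcB.
have h2 : (sqnorm (fun z => (powshift a l0 p t z - g z)%R) < d%:E)%E.
  by rewrite (_ : sqnorm _ = sqnorm (fun z => (powshift a l0 p t z - cpow z l0 * P.[cpow z a%:C])%R))//;
    apply: eq_sqnorm => z _; rewrite gE.
have h3 := sqnorm_triangle_lt cp cs cg h1 h2.
have h4 := sqnorm_triangle_lt cf cp cg Hp h3.
apply: lt_le_trans h4 _; rewrite lee_fin /d; have := sqr_ge0 e; lra.
Qed.
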